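(* Let $X$ be a reflexive diffeological space. Then $(\mathcal{P}(X),X)$, with structure maps $\sigma(u)=u(0)$, $\tau(u)=u(1)$ for $u\in\mathcal{P}(X)$ and $\iota(x)=$ the constant path at $x\in X$, is an internal smooth h-unital $A_\infty$-category in the category of diffeological spaces.
   Context: **Diffeology.** $\mathbb{N}$ is the set of non-negative integers. Diffeological spaces have plots defined on open subsets of Euclidean spaces $\mathbb{R}^m$, $m\in\mathbb{N}$. Subsets carry the subspace diffeology, products the product diffeology, and $C^\infty(A,B)$ the functional diffeology. A subduction is a smooth surjection whose target carries the push-forward diffeology. For smooth maps $f,g:A\to B$, $f\simeq g$ means that they are smoothly homotopic, i.e. there is a smooth map $H:\mathbb{R}\times A\to B$ with $H(0,\cdot)=f$ and $H(1,\cdot)=g$. **Reflexivity.** A diffeological space $X$ is reflexive if every map $P:U\to X$ from an open subset $U$ of some $\mathbb{R}^m$, such that $\varphi\circ P$ is smooth for every smooth $\varphi:X\to\mathbb{R}$, is a plot of $X$. **Paths.** Let $\pi_{set}:\mathbb{R}\to\mathbb{R}$, $\pi_{set}(t)=\max\{0,\min\{1,t\}\}$. $\mathcal{P}(X)=\{u\in C^\infty(\mathbb{R},X)\mid u\circ\pi_{set}=u\}$, as a diffeological subspace of $C^\infty(\mathbb{R},X)$. **Associahedra as smooth cubic complexes.** For $n\ge2$ let $K_n=\{(t_1,\dots,t_n)\in\mathbb{R}^n\mid t_1=0,\ 0\le t_k\le k-1-\sum_{i=1}^{k-1}t_i\ (1<k<n),\ t_n=n-1-\sum_{i=1}^{n-1}t_i\}$,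 and let $\mathbb{b}_n=(0,\tfrac12,\dots,\tfrac12,\tfrac n2)\in K_n$ (so $\mathbb b_2=(0,1)$ and $K_2=\{\mathbb b_2\}$). For $r,s\ge2$, $r+s=n+1$, $1\le k\le r$, the face operator $\partial_k:\mathbb{R}^r\times\mathbb{R}^s\to\mathbb{R}^n$ is the linear map $\partial_k((t_1,\dots,t_r),(u_1,\dots,u_s))=(t_1,\dots,t_{k-1},u_1,\dots,u_{s-1},u_s+t_k,t_{k+1},\dots,t_r)$ (for $k=1$ this reads $(u_1,\dots,u_{s-1},u_s+t_1,t_2,\dots,t_r)$); it maps $K_r\times K_s$ bijectively onto a face $L_k(r,s)$ of $K_n$. The boundary of $K_n$ is the union of these faces, and $K_n$ is the union of the cones $L_k(r,s)\ast\mathbb b_n$ (for $n\ge3$). The cubic complex $\mathbb{K}(n)$ is a finite set of cells $\sigma\subset K_n$, each nonempty cell equipped with a surjection $\pi_\sigma:\mathbb{R}^q\to\sigma$, $q=\dim\sigma$, defined inductively: - $\mathbb{K}(2)=\{\emptyset,\{\mathbb b_2\}\}$. - For $n\ge3$, $\mathbb{K}(n)$ consists of $\emptyset$, $\{\mathbb b_n\}$, all cells $\sigma=\partial_k(\rho\times\kappa)$ with $r+s=n+1$, $r,s\ge 2$, $1\le k\le r$ and nonempty $\rho\in\mathbb{K}(r)$, $\kappa\in\mathbb{K}(s)$, where $\pi_\sigma=\partial_k\circ(\pi_\rho\times\pi_\kappa)$, and all joins $\sigma\ast\mathbb b_n=\{(1-t)x+t\,\mathbb b_n\mid x\in\sigma,\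 t\in[0,1]\}$ of such $\sigma$, where $\pi_{\sigma\ast\mathbb b_n}(x,t)=(1-\pi_{set}(t))\pi_\sigma(x)+\pi_{set}(t)\,\mathbb b_n$ for $(x,t)\in\mathbb{R}^{\dim\sigma}\times\mathbb{R}$. Each cell $\sigma$ carries the diffeology for which $\pi_\sigma$ is a subduction (one-point cells are trivial). $|\mathbb{K}(n)|$ is $K_n$ as a set, with the diffeology of the colimit of the cells (the finest diffeology for which all inclusions of cells are smooth). **Internal h-unital $A_\infty$-category.** An internal precategory $(G,X)$ is a pair of diffeological spaces with smooth maps $\sigma,\tau:G\to X$ and $\iota:X\to G$ satisfying $\sigma\circ\iota=\tau\circ\iota=\mathrm{id}_X$. Write $G^n=\{(g_1,\dots,g_n)\mid g_i\in G,\ \tau(g_i)=\sigma(g_{i+1})\ (1\le i<n)\}$, the iterated pullback over $X$, as a subspace of the $n$-fold product of $G$. $(G,X)$ is an internal smooth h-unital $A_\infty$-category if there is a series of smooth maps $\{M(n):|\mathbb{K}(n)|\times G^n\to G\}_{n\ge2}$ (an $A_\infty$-form) such that: (0) $\sigma(M(n)(a;g_1,\dots,g_n))=\sigma(g_1)$ and $\tau(M(n)(a;g_1,\dots,g_n))=\tau(g_n)$ for all $a\in|\mathbb{K}(n)|$, $(g_1,\dots,g_n)\in G^n$; (1) $M(n)(\partial_k(\rho,\kappa);g_1,\dots,g_n)=M(r)(\rho;g_1,\dots,g_{k-1},M(s)(\kappa;g_k,\dots,g_{k+s-1}),g_{k+s},\dots,g_n)$ for all $r,s\ge2$, $r+s=n+1$,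 $1\le k\le r$, $\rho\in|\mathbb{K}(r)|$, $\kappa\in|\mathbb{K}(s)|$, $(g_1,\dots,g_n)\in G^n$; (2') the maps $G\to G$, $g\mapsto M(2)(\mathbb b_2;\iota(\sigma(g)),g)$ and $g\mapsto M(2)(\mathbb b_2;g,\iota(\tau(g)))$ are each smoothly homotopic to the identity of $G$. *)

(* Defs.v *)
From HB Require Import structures.
From mathcomp Require Import all_boot all_order all_algebra.
From mathcomp Require Import all_classical all_reals all_analysis.
From mathcomp Require Import zify lra.

Set Implicit Arguments.
Unset Strict Implicit.
Unset Printing Implicit Defensive.

Import Order.TTheory GRing.Theory Num.Theory.
Import numFieldNormedType.Exports.

Local Open Scope classical_set_scope.
Local Open Scope ring_scope.

(* C^k real functions on an open set U; only the restriction of f to U matters. *)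
Fixpoint Ck (R : realType) (m k : nat) (U : set 'rV[R]_m) (f : 'rV[R]_m -> R)
    : Prop :=
  match k with
  | 0 => forall x, U x -> {for x, continuous f}
  | k'.+1 => (forall x, U x -> differentiable f x) /\
             (forall i : 'I_m, Ck k' U (fun x => 'D_'e_i f x))
  end.

Definition smooth_on (R : realType) (m : nat) (U : set 'rV[R]_m)
  (f : 'rV[R]_m -> R) : Prop := forall k, Ck k U f.

Definition smooth_on_rV (R : realType) (m n : nat) (U : set 'rV[R]_m)
    (f : 'rV[R]_m -> 'rV[R]_n) : Prop :=
  forall j : 'I_n, smooth_on U (fun x => f x 0 j).

Section Ck_theory.
Variable R : realType.
Implicit Types m n k : nat.

Lemma near_eq_differentiable (V W : normedModType R) (f g : V -> W) (x : V) :
  {near x, f =1 g} -> differentiable f x -> differentiable g x.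
Proof.
move=> fg df; have -> : g = f + (g - f) by rewrite addrC subrK.
apply: differentiableD => //; set e := g - f.
have ne : \forall y \near x, e y = 0.
  by apply: filterS fg => y fgy; rewrite /e !fctE fgy subrr.
have ex : e x = 0 by exact: nbhs_singleton ne.
have key : e \o shift x = cst (e x) + (\0 : {linear V -> W}) +o_ 0 id.
  apply/eqaddoP => _/posnumP[eps]; near=> h.
  rewrite !fctE /= ex /cst /= add0r subr0.
  rewrite (_ : e _ = 0) ?normr0 ?mulr_ge0//.
  near: h; have := ne; rewrite (near_shift 0) /= subr0.
  by apply: filterS => h /=; rewrite ?subr0.
have c0 : continuous (\0 : {linear V -> W}) by exact: cst_continuous.
apply/diff_locallyP; have d0 := diff_unique c0 key.
by rewrite d0; split.
Unshelve. all: by end_near. Qed.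

Lemma open_near_eq m (U : set 'rV[R]_m) (T : Type) (f g : 'rV[R]_m -> T) x :
  open U -> (forall x, U x -> f x = g x) -> U x -> {near x, f =1 g}.
Proof.
move=> oU fg Ux; have nU : nbhs x U by exact: open_nbhs_nbhs.
by apply: filterS nU.
Qed.

Lemma Ck_ext m k (U : set 'rV[R]_m) (f g : 'rV[R]_m -> R) :
  open U -> (forall x, U x -> f x = g x) -> Ck k U f -> Ck k U g.
Proof.
move=> oU; elim: k f g => [|k IH] f g fg /=.
  move=> cf x Ux; have nfg := open_near_eq oU fg Ux.
  rewrite /prop_for /continuous_at -(fg _ Ux).
  have cfx : f y @[y --> x] --> f x := cf x Ux.
  by apply: cvg_trans cfx; apply: (near_eq_cvg nfg).
case=> df Df; split=> [x Ux|i].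
  exact: (near_eq_differentiable (open_near_eq oU fg Ux) (df x Ux)).
apply: IH (Df i) => x Ux; apply: near_eq_derive.
exact: (open_near_eq oU fg Ux).
Qed.

Lemma Ck_sub m k (U V : set 'rV[R]_m) (f : 'rV[R]_m -> R) :
  V `<=` U -> Ck k U f -> Ck k V f.
Proof.
move=> VU; elim: k f => [|k IH] f /=; first by move=> cf x /VU; exact: cf.
by case=> df Df; split=> [x /VU|i]; [exact: df|exact: IH].
Qed.

Lemma Ck_local m k (U : set 'rV[R]_m) (f : 'rV[R]_m -> R) :
  (forall x, U x -> exists2 V : set 'rV[R]_m, V x & Ck k V f) -> Ck k U f.
Proof.
elim: k f => [|k IH] f H /=; first by move=> x /H[V Vx cf]; exact: cf.
split=> [x /H[V Vx [df _]]|i]; first exact: df.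
by apply: IH => x /H[V Vx [_ Df]]; exists V => //; exact: Df.
Qed.

Lemma CkS m k (U : set 'rV[R]_m) (f : 'rV[R]_m -> R) :
  Ck k.+1 U f -> Ck k U f.
Proof.
elim: k f => [|k IH] f [df Df].
  by move=> x Ux; exact/differentiable_continuous/df.
by split=> // i; exact/IH/Df.
Qed.

Lemma Ck_cst m k (U : set 'rV[R]_m) (c : R) : Ck k U (fun=> c).
Proof.
elim: k c => [|k IH] c /=; first by move=> x _; exact: cst_continuous.
split=> [x _|i]; first exact: differentiable_cst.
suff -> : (fun x : 'rV[R]_m => 'D_'e_i (fun=> c) x) = (fun=> 0) by exact: IH.
by rewrite funeqE => x; rewrite derive_cst.
Qed.

Lemma CkD m k (U : set 'rV[R]_m) (f g : 'rV[R]_m -> R) :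
  open U -> Ck k U f -> Ck k U g -> Ck k U (fun x => f x + g x).
Proof.
move=> oU; elim: k f g => [|k IH] f g /=.
  by move=> cf cg x Ux; apply: continuousD; [exact: cf|exact: cg].
case=> df Df [dg Dg]; split=> [x Ux|i].
  by apply: differentiableD; [exact: df|exact: dg].
apply: Ck_ext (IH _ _ (Df i) (Dg i)) => // x Ux.
by rewrite deriveD//; apply: diff_derivable; [exact: df|exact: dg].
Qed.

Lemma CkM m k (U : set 'rV[R]_m) (f g : 'rV[R]_m -> R) :
  open U -> Ck k U f -> Ck k U g -> Ck k U (fun x => f x * g x).
Proof.
move=> oU; elim: k f g => [|k IH] f g.
  by move=> cf cg x Ux; apply: continuousM; [exact: cf|exact: cg].
move=> Cf Cg; have [df Df] := Cf; have [dg Dg] := Cg; split=> [x Ux|i].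
  by apply: differentiableM; [exact: df|exact: dg].
have /= := CkD oU (IH _ _ (CkS Cf) (Dg i)) (IH _ _ (CkS Cg) (Df i)).
apply: Ck_ext => // x Ux.
by rewrite deriveM//; apply: diff_derivable; [exact: df|exact: dg].
Qed.

Lemma Ck_sum m k (I : Type) (r : seq I) (U : set 'rV[R]_m)
    (f : I -> 'rV[R]_m -> R) :
  open U -> (forall i, Ck k U (f i)) -> Ck k U (fun x => \sum_(i <- r) f i x).
Proof.
move=> oU Cf; elim: r => [|i r IH].
  by apply: Ck_ext (@Ck_cst m k U 0) => // x _; rewrite big_nil.
by apply: Ck_ext (CkD oU (Cf i) IH) => // x _; rewrite big_cons.
Qed.

Lemma rV_continuous m n (g : 'rV[R]_m -> 'rV[R]_n) x :
  (forall j, {for x, continuous (fun y => g y 0 j)}) -> {for x, continuous g}.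
Proof.
have F : Filter (nbhs x) by exact: nbhs_filter.
move=> cg; apply/(@cvgrPdist_le R 'rV[R]_n _ (nbhs x) F) => /= e e0.
have : \forall y \near x, forall j, `|g x 0 j - g y 0 j| <= e.
  apply: (@filter_forall _ _ _ _ F) => j.
  by have /cvgrPdist_le := cg j; exact.
apply: filterS => y gxy.
rewrite /Num.Def.normr/= mx_normrE (bigmax_le _ (ltW e0))//= => -[i j] _ /=.
by rewrite !mxE (ord1 i).
Qed.

Lemma rV_differentiable m n (g : 'rV[R]_m -> 'rV[R]_n) x :
  (forall j, differentiable (fun y => g y 0 j) x) -> differentiable g x.
Proof.
move=> dg.
have -> : g = \sum_(j < n) (fun y => g y 0 j *: (delta_mx 0 j : 'rV[R]_n)).
  by rewrite funeqE => y; rewrite [LHS]row_sum_delta fct_sumE.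
by apply: differentiable_sum => j; apply: differentiableZl.
Qed.

Lemma Ck_comp m n k (U : set 'rV[R]_n) (V : set 'rV[R]_m)
    (f : 'rV[R]_n -> R) (g : 'rV[R]_m -> 'rV[R]_n) :
  open V -> (forall x, V x -> U (g x)) ->
  (forall j, Ck k V (fun x => g x 0 j)) ->
  Ck k U f -> Ck k V (fun x => f (g x)).
Proof.
move=> oV gVU; elim: k f => [|k IH] f Cg Cf.
  move=> x Vx; apply: continuous_comp; last exact/Cf/gVU.
  by apply: rV_continuous => j; exact: Cg.
have dg x : V x -> differentiable g x.
  by move=> Vx; apply: rV_differentiable => j; exact: (Cg j).1.
have [df Df] := Cf.
split=> [x Vx|i].
  by apply: differentiable_comp; [exact: dg|exact/df/gVU].
have step j := CkM oV ((Cg j).2 i) (IH _ (fun j => CkS (Cg j)) (Df j)).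
apply: Ck_ext (Ck_sum (index_enum 'I_n) oV step) => // x Vx.
have dgx := dg _ Vx; have dfx := df _ (gVU _ Vx).
rewrite [RHS]deriveE; last exact: differentiable_comp.
rewrite diff_comp//=.
have -> : 'd g x 'e_i = \sum_(j < n) 'D_'e_i (fun y => g y 0 j) x *: 'e_j.
  rewrite -deriveE// derive_mx; last exact: diff_derivable.
  by rewrite [LHS]row_sum_delta; apply: eq_bigr => j _; rewrite mxE.
rewrite linear_sum; apply: eq_bigr => j _.
by rewrite linearZ (deriveE _ dfx).
Qed.

Lemma smooth_on_coord m (U : set 'rV[R]_m) (j : 'I_m) :
  smooth_on U (fun x => x 0 j).
Proof.
case=> [|k] /=; first by move=> x _; exact: coord_continuous.
split=> [x _|i]; first exact: differentiable_coord.
suff -> : (fun x : 'rV[R]_m => 'D_'e_i (fun x : 'rV[R]_m => x 0 j) x)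
   = (fun=> ('e_i : 'rV[R]_m) 0 j) by exact: Ck_cst.
rewrite funeqE => x.
have did : derivable (@id 'rV[R]_m) x 'e_i by exact: derivable_id.
have := derive_mx did; rewrite derive_id => /matrixP /(_ 0 j).
by rewrite [in X in _ = X -> _]mxE => ->.
Qed.

End Ck_theory.

Section smooth_on_theory.
Variable R : realType.
Implicit Types m n p : nat.

Lemma smooth_on_rV_comp m n p (U : set 'rV[R]_n) (V : set 'rV[R]_m)
    (f : 'rV[R]_n -> 'rV[R]_p) (g : 'rV[R]_m -> 'rV[R]_n) :
  open V -> V `<=` g @^-1` U ->
  smooth_on_rV V g -> smooth_on_rV U f -> smooth_on_rV V (f \o g).
Proof.
move=> oV gVU sg sf j k.
apply: (@Ck_comp R m n k U V (fun y => f y 0 j) g) => // [i|]; first exact: sg.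
exact: sf.
Qed.

Lemma smooth_on_rV_sub m n (U V : set 'rV[R]_m) (f : 'rV[R]_m -> 'rV[R]_n) :
  V `<=` U -> smooth_on_rV U f -> smooth_on_rV V f.
Proof. by move=> VU sf j k; apply: Ck_sub VU _; exact: sf. Qed.

Lemma smooth_on_rV_id m (U : set 'rV[R]_m) : smooth_on_rV U id.
Proof. by move=> j; exact: smooth_on_coord. Qed.

Lemma smooth_on_rV_open_preimage m n (U : set 'rV[R]_m) (V : set 'rV[R]_n)
    (f : 'rV[R]_m -> 'rV[R]_n) :
  open U -> open V -> smooth_on_rV U f -> open (U `&` f @^-1` V).
Proof.
move=> oU oV sf; rewrite openE => x [Ux Vfx]; apply: filterI.
  exact: open_nbhs_nbhs.
have cf : {for x, continuous f}.
  by apply: rV_continuous => j; exact: (sf j 0%N x Ux).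
by apply: cf; exact: open_nbhs_nbhs.
Qed.

End smooth_on_theory.

(* A plot U -> X is represented by a total map on R^m of which only the values
   on U matter (plot_ext).  Every map U -> X extends so, except the empty one
   when X is empty, and an empty X has a single diffeology anyway. *)
Record diffeology (R : realType) (X : Type) := Diffeology {
  plot : forall m, set 'rV[R]_m -> ('rV[R]_m -> X) -> Prop ;
  plot_open : forall m (U : set 'rV[R]_m) P, plot U P -> open U ;
  plot_ext : forall m (U : set 'rV[R]_m) P Q,
    (forall u, U u -> P u = Q u) -> plot U P -> plot U Q ;
  plot_cst : forall m (U : set 'rV[R]_m) (x : X), open U -> plot U (fun=> x) ;
  plot_comp : forall m n (U : set 'rV[R]_m) (V : set 'rV[R]_n) P f,
    plot U P -> open V -> smooth_on_rV V f -> V `<=` f @^-1` U ->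
    plot V (P \o f) ;
  plot_local : forall m (U : set 'rV[R]_m) P, open U ->
    (forall u, U u -> exists2 V : set 'rV[R]_m, V u & plot V P) -> plot U P
}.

Record diffSpace (R : realType) := DiffSpace {
  carrier :> Type ;
  structure : diffeology R carrier
}.

Definition is_plot (R : realType) (X : diffSpace R) m (U : set 'rV[R]_m)
  (P : 'rV[R]_m -> X) : Prop := plot (structure X) U P.

Definition smooth_wrt (R : realType) (X Y : Type) (D : diffeology R X)
    (E : diffeology R Y) (f : X -> Y) : Prop :=
  forall m (U : set 'rV[R]_m) P, plot D U P -> plot E U (f \o P).

Definition smooth (R : realType) (X Y : diffSpace R) (f : X -> Y) : Prop :=
  smooth_wrt (structure X) (structure Y) f.

Record smooth_map (R : realType) (X Y : diffSpace R) := SmoothMap {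
  smooth_fun :> X -> Y ;
  smooth_funP : smooth smooth_fun
}.

Section constructions.
Variable R : realType.
Implicit Types X Y A B : diffSpace R.

Program Definition euclidean_diffeology n : diffeology R 'rV[R]_n :=
  @Diffeology R 'rV[R]_n (fun m U P => open U /\ smooth_on_rV U P) _ _ _ _ _.
Next Obligation. by move=> n m U P []. Qed.
Next Obligation.
move=> n m U P Q PQ [oU sP]; split=> // j k.
by apply: Ck_ext (sP j k) => // u Uu; rewrite PQ.
Qed.
Next Obligation. by move=> n m U x oU; split=> // j k; exact: Ck_cst. Qed.
Next Obligation.
move=> n m p U V P f [oU sP] oV sf VU; split=> //.
exact: (smooth_on_rV_comp oV VU sf sP).
Qed.
Next Obligation.
move=> n m U P oU H; split=> // j k; apply: Ck_local => u /H[V Vu [_ sP]].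
by exists V => //; exact: sP.
Qed.

Definition euclidean n : diffSpace R := DiffSpace (euclidean_diffeology n).

Program Definition real_diffeology : diffeology R R :=
  @Diffeology R R (fun m U P => open U /\ smooth_on U P) _ _ _ _ _.
Next Obligation. by move=> m U P []. Qed.
Next Obligation.
move=> m U P Q PQ [oU sP]; split=> // k.
by apply: Ck_ext (sP k) => // u Uu; rewrite PQ.
Qed.
Next Obligation. by move=> m U x oU; split=> // k; exact: Ck_cst. Qed.
Next Obligation.
move=> m p U V P f [oU sP] oV sf VU; split=> // k.
by apply: (@Ck_comp R p m k U V P f) => // j; exact: sf.
Qed.
Next Obligation.
move=> m U P oU H; split=> // k; apply: Ck_local => u /H[V Vu [_ sP]].
by exists V => //; exact: sP.
Qed.

Definition realLine : diffSpace R := DiffSpace real_diffeology.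

Program Definition sub_diffeology X (S : set X) : diffeology R {x : X | S x} :=
  @Diffeology R _ (fun m U P => is_plot U (fun u => sval (P u))) _ _ _ _ _.
Next Obligation. by move=> X S m U P; exact: plot_open. Qed.
Next Obligation.
by move=> X S m U P Q PQ; apply: plot_ext => u Uu; rewrite PQ.
Qed.
Next Obligation. by move=> X S m U x oU; exact: plot_cst. Qed.
Next Obligation. by move=> X S m n U V P f; exact: plot_comp. Qed.
Next Obligation. by move=> X S m U P; exact: plot_local. Qed.

Definition subSpace X (S : set X) : diffSpace R := DiffSpace (sub_diffeology S).

Program Definition prod_diffeology X Y : diffeology R (X * Y) :=
  @Diffeology R _ (fun m U P =>
    is_plot U (fun u => (P u).1) /\ is_plot U (fun u => (P u).2)) _ _ _ _ _.
Next Obligation. by move=> X Y m U P [/plot_open]. Qed.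
Next Obligation.
by move=> X Y m U P Q PQ [P1 P2]; split;
  [apply: plot_ext P1|apply: plot_ext P2] => u Uu; rewrite PQ.
Qed.
Next Obligation. by move=> X Y m U x oU; split; exact: plot_cst. Qed.
Next Obligation.
move=> X Y m n U V P f [P1 P2] oV sf VU; split.
  exact: (plot_comp P1 oV sf VU).
exact: (plot_comp P2 oV sf VU).
Qed.
Next Obligation.
by move=> X Y m U P oU H; split; apply: plot_local => // u /H[V Vu []]; exists V.
Qed.

Definition prodSpace X Y : diffSpace R := DiffSpace (prod_diffeology X Y).

Program Definition power_diffeology X n : diffeology R ('I_n -> X) :=
  @Diffeology R _ (fun m U P =>
    open U /\ forall i, is_plot U (fun u => P u i)) _ _ _ _ _.
Next Obligation. by move=> X n m U P []. Qed.
Next Obligation.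
move=> X n m U P Q PQ [oU HP]; split=> // i.
by apply: plot_ext (HP i) => u Uu; rewrite PQ.
Qed.
Next Obligation. by move=> X n m U x oU; split=> // i; exact: plot_cst. Qed.
Next Obligation.
move=> X n m p U V P f [oU HP] oV sf VU; split=> // i.
exact: (plot_comp (HP i) oV sf VU).
Qed.
Next Obligation.
move=> X n m U P oU H; split=> // i; apply: plot_local => // u /H[V Vu [_ HP]].
by exists V => //; exact: HP.
Qed.

Definition powerSpace X n : diffSpace R := DiffSpace (power_diffeology X n).

(* P : U -> C^oo(A, B) is a plot iff (u, a) |-> P u a is smooth on U x A; a plot
   of U x A is a pair of a smooth map Q into U and a plot q of A. *)
Program Definition functional_diffeology A B : diffeology R (smooth_map A B) :=
  @Diffeology R _ (fun m U P => open U /\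
    forall n (W : set 'rV[R]_n) (Q : 'rV[R]_n -> 'rV[R]_m) (q : 'rV[R]_n -> A),
      smooth_on_rV W Q -> W `<=` Q @^-1` U -> is_plot W q ->
      is_plot W (fun w => P (Q w) (q w))) _ _ _ _ _.
Next Obligation. by move=> A B m U P []. Qed.
Next Obligation.
move=> A B m U P P' PP' [oU HP]; split=> // n W Q q sQ WU pq.
by apply: plot_ext (HP _ _ _ _ sQ WU pq) => w /WU /= UQw; rewrite PP'.
Qed.
Next Obligation.
by move=> A B m U f oU; split=> // n W Q q _ _; exact: smooth_funP.
Qed.
Next Obligation.
move=> A B m p U V P f [oU HP] oV sf VU; split=> // n W Q q sQ WV pq.
apply: (HP n W (f \o Q)) => //; last by move=> w /WV /VU.
exact: (smooth_on_rV_comp (plot_open pq) WV sQ sf).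
Qed.
Next Obligation.
move=> A B m U P oU H; split=> // n W Q q sQ WU pq.
have oW := plot_open pq.
apply: plot_local => // w Ww; have [V Vw [oV HP]] := H _ (WU _ Ww).
exists (W `&` Q @^-1` V); first by split.
apply: HP => [||].
- exact: smooth_on_rV_sub sQ.
- by move=> ? [].
- have oWV := smooth_on_rV_open_preimage oW oV sQ.
  exact: (plot_comp pq oWV (@smooth_on_rV_id _ _ _) (@subIsetl _ _ _)).
Qed.

Definition mapSpace A B : diffSpace R := DiffSpace (functional_diffeology A B).

(* The finest diffeology on Z for which all the f i are smooth, as the
   intersection of the diffeologies with this property. *)
Program Definition final_diffeology (I : Type) (A : I -> diffSpace R) (Z : Type)
    (f : forall i, A i -> Z) : diffeology R Z :=
  @Diffeology R Z (fun m U P => open U /\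
    forall D : diffeology R Z,
      (forall i, smooth_wrt (structure (A i)) D (f i)) -> plot D U P) _ _ _ _ _.
Next Obligation. by move=> I A Z f m U P []. Qed.
Next Obligation.
move=> I A Z f m U P Q PQ [oU HP]; split=> // D fD.
exact: plot_ext (HP D fD).
Qed.
Next Obligation. by move=> I A Z f m U z oU; split=> // D _; exact: plot_cst. Qed.
Next Obligation.
move=> I A Z f m n U V P g [oU HP] oV sg VU; split=> // D fD.
exact: plot_comp (HP D fD) oV sg VU.
Qed.
Next Obligation.
move=> I A Z f m U P oU H; split=> // D fD; apply: plot_local => // u /H[V Vu [_ HP]].
by exists V => //; exact: HP.
Qed.

(* A surjection f is a subduction onto Z with this diffeology. *)
Definition pushforward_diffeology X (Z : Type) (f : X -> Z) : diffeology R Z :=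
  final_diffeology (fun _ : unit => f).

Definition smoothly_homotopic A B (f g : A -> B) : Prop :=
  exists H : prodSpace realLine A -> B,
    [/\ smooth H, forall a, H (0, a) = f a & forall a, H (1, a) = g a].

Definition reflexive_space X : Prop :=
  forall m (U : set 'rV[R]_m) (P : 'rV[R]_m -> X), open U ->
    (forall phi : X -> realLine, smooth phi -> smooth_on U (phi \o P)) ->
    is_plot U P.

Definition pi_set (t : R) : R := Num.max 0 (Num.min 1 t).

Definition pathSpace X : diffSpace R :=
  subSpace [set u : mapSpace realLine X | (u : R -> X) \o pi_set = u].

Definition path_at X (u : pathSpace X) (t : R) : X := smooth_fun (sval u) t.

Lemma smooth_cst X (x : X) : smooth (fun _ : realLine => x).
Proof. by move=> m U P pP; apply: plot_cst; exact: plot_open pP. Qed.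

Definition constant_path X (x : X) : pathSpace X :=
  exist _ (SmoothMap (smooth_cst x)) (erefl : (fun=> x) \o pi_set = (fun=> x)).

End constructions.

Section associahedra.
Variable R : realType.
Implicit Types n r s k : nat.

(* t_k for 1 <= k <= n, numbered from 1, and 0 for the other values of k. *)
Definition coord n (t : 'rV[R]_n) k : R :=
  if [pick i : 'I_n | i.+1 == k] is Some i then t 0 i else 0.

Definition associahedron n : set 'rV[R]_n :=
  [set t | [/\ coord t 1 = 0,
    (forall k, (1 < k < n)%N ->
       0 <= coord t k <= k%:R - 1 - \sum_(1 <= i < k) coord t i) &
    coord t n = n%:R - 1 - \sum_(1 <= i < n) coord t i]].

Definition base_point n : 'rV[R]_n :=
  \row_(i < n) (if i == 0 :> nat then 0
                else if i.+1 == n then n%:R / 2 else 1 / 2).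

Definition face_index r s n k : bool :=
  [&& (2 <= r)%N, (2 <= s)%N, (r + s == n.+1)%N & (1 <= k <= r)%N].

Definition face r s n k (t : 'rV[R]_r) (u : 'rV[R]_s) : 'rV[R]_n :=
  \row_(i < n)
    (let j := i.+1 in
     if (j < k)%N then coord t j
     else if (j < k + s - 1)%N then coord u (j - k + 1)
     else if j == (k + s - 1)%N then coord u s + coord t k
     else coord t (j - s + 1)).

Lemma coordE n (f : nat -> R) k : (1 <= k <= n)%N ->
  coord (\row_(i < n) f i.+1) k = f k.
Proof.
move=> kn; rewrite /coord; case: pickP => [i /eqP <-|]; first by rewrite mxE.
have kn' : (k.-1 < n)%N by lia.
by move=> /(_ (Ordinal kn')) /=; rewrite prednK ?eqxx//; lia.
Qed.

Lemma coordD n (t u : 'rV[R]_n) k : coord (t + u) k = coord t k + coord u k.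
Proof. by rewrite /coord; case: pickP => [i _|_]; rewrite ?mxE ?addr0. Qed.

Lemma coordZ n (a : R) (t : 'rV[R]_n) k : coord (a *: t) k = a * coord t k.
Proof. by rewrite /coord; case: pickP => [i _|_]; rewrite ?mxE ?mulr0. Qed.

Lemma associahedron_convex n (t u : 'rV[R]_n) (a : R) : 0 <= a <= 1 ->
  associahedron t -> associahedron u -> associahedron ((1 - a) *: t + a *: u).
Proof.
move=> /andP[a0 a1] [t1 tk tn] [u1 uk un].
have S k : \sum_(1 <= i < k) coord ((1 - a) *: t + a *: u) i =
    (1 - a) * \sum_(1 <= i < k) coord t i + a * \sum_(1 <= i < k) coord u i.
  rewrite !mulr_sumr -big_split; apply: eq_bigr => i _ /=.
  by rewrite coordD !coordZ.
split.
- by rewrite coordD !coordZ t1 u1 !mulr0 addr0.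
- move=> k kn; have /andP[? ?] := tk _ kn; have /andP[? ?] := uk _ kn.
  by rewrite S coordD !coordZ; apply/andP; split; nra.
- by rewrite S coordD !coordZ tn un; lra.
Qed.

Lemma associahedronP n (t : 'rV[R]_n) : (2 <= n)%N ->
  associahedron t <->
  [/\ coord t 1 = 0, forall k, (1 <= k <= n)%N -> 0 <= coord t k,
    forall k, (1 <= k <= n)%N -> \sum_(1 <= i < k.+1) coord t i <= k%:R - 1 &
    \sum_(1 <= i < n.+1) coord t i = n%:R - 1].
Proof.
move=> n2; have n1 : (1 <= n)%N by lia.
split=> [[t1 tk tn]|[t1 t0 tk tn]].
  have le k : (1 <= k < n)%N -> \sum_(1 <= i < k.+1) coord t i <= k%:R - 1.
    move=> kn; have k1 : (1 <= k)%N by lia.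
    rewrite big_nat_recr//=; have [k2|k2] := ltnP 1 k.
      by have /andP[_] := tk k ltac:(lia); lra.
    have -> : k = 1%N by lia.
    by rewrite big_geq// t1; lra.
  have eqn : \sum_(1 <= i < n.+1) coord t i = n%:R - 1.
    by rewrite big_nat_recr//= tn; lra.
  split=> // k kn; last first.
    have [->|kn'] := eqVneq k n; first by rewrite eqn.
    by apply: le; lia.
  have [->|k1] := eqVneq k 1%N; first by rewrite t1.
  have [->|kn'] := eqVneq k n.
    rewrite tn; have := le n.-1 ltac:(lia).
    rewrite prednK; last by lia.
    have -> : n%:R = n.-1%:R + 1 :> R by rewrite natr1 prednK//; lia.
    by lra.
  by have /andP[] := tk k ltac:(lia).
split=> //.
  move=> k kn; rewrite t0; last by lia.
  have := tk k ltac:(lia); rewrite big_nat_recr/=; last by lia.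
  by lra.
by move: tn; rewrite big_nat_recr//=; lra.
Qed.

Lemma base_point_in n : (2 <= n)%N -> associahedron (base_point n).
Proof.
move=> n2; pose b k : R := if k == 1%N then 0 else if k == n then n%:R / 2 else 1 / 2.
have cb k : (1 <= k <= n)%N -> coord (base_point n) k = b k by exact: coordE.
have S k : (1 <= k < n)%N ->
    \sum_(1 <= i < k.+1) coord (base_point n) i = (k%:R - 1) / 2.
  elim: k => [|k IH] kn; first by lia.
  rewrite big_nat_recr//=; have [->|k0] := eqVneq k 0%N.
    by rewrite big_geq// cb /b/=; [lra|lia].
  rewrite IH ?cb; [|lia|lia].
  rewrite /b -natr1 !ifF; [lra| |]; by apply/negbTE/eqP; lia.
have nS : n%:R = n.-1%:R + 1 :> R by rewrite natr1 prednK//; lia.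
have Sn : \sum_(1 <= i < n.+1) coord (base_point n) i = n%:R - 1.
  rewrite big_nat_recr//=; last by lia.
  have := S n.-1 ltac:(lia); rewrite prednK; last by lia.
  move=> ->; rewrite cb /b ?eqxx ?ifF; [lra|by apply/negbTE/eqP; lia|lia].
apply/associahedronP => //; split=> //.
- by rewrite cb//; lia.
- move=> k kn; rewrite cb// /b; case: ifP => // _.
  by case: ifP => _; rewrite divr_ge0.
- move=> k kn; have [->|kn'] := eqVneq k n; first by rewrite Sn.
  rewrite S; last by lia.
  have : 1 <= k%:R :> R by rewrite ler1n; lia.
  by lra.
Qed.

Lemma face_in r s n k (t : 'rV[R]_r) (u : 'rV[R]_s) : face_index r s n k ->
  associahedron t -> associahedron u -> associahedron (face n k t u).
Proof.
move=> /and4P[r2 s2 /eqP rsn /andP[k1 kr]] /(associahedronP _ r2)[t1 t0 tk tr].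
move=> /(associahedronP _ s2)[u1 u0 uk us].
have n2 : (2 <= n)%N by lia.
pose Pt j := \sum_(1 <= i < j.+1) coord t i.
pose Pu j := \sum_(1 <= i < j.+1) coord u i.
have PtS j : Pt j.+1 = Pt j + coord t j.+1 by rewrite /Pt big_nat_recr.
have PuS j : Pu j.+1 = Pu j + coord u j.+1 by rewrite /Pu big_nat_recr.
pose v j : R := if (j < k)%N then coord t j
     else if (j < k + s - 1)%N then coord u (j - k + 1)
     else if j == (k + s - 1)%N then coord u s + coord t k
     else coord t (j - s + 1).
have cv j : (1 <= j <= n)%N -> coord (face n k t u) j = v j by exact: coordE.
pose Pv j : R := if (j < k)%N then Pt j
     else if (j < k + s - 1)%N then Pt k.-1 + Pu (j - k + 1)%N
     else Pt (j - s + 1)%N + Pu s.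
have S j : (j <= n)%N -> \sum_(1 <= i < j.+1) coord (face n k t u) i = Pv j.
  elim: j => [|j IH] jn; first by rewrite big_geq// /Pv ifT// /Pt big_geq.
  rewrite big_nat_recr//= IH ?cv; [|lia|lia].
  rewrite /Pv /v; have [jk|jk] := ltnP j.+1 k.
    by rewrite ifT ?PtS//; lia.
  have [jk'|jk'] := ltnP j k.
    have -> : j = k.-1 by lia.
    rewrite prednK// ifT; last by lia.
    rewrite ifT; last by lia.
    rewrite subnn add0n; congr (_ + _).
    by rewrite /Pu big_nat_recr//= big_geq// add0r.
  have [js|js] := ltnP j.+1 (k + s - 1).
    rewrite ifT; last by lia.
    have -> : (j.+1 - k + 1 = (j - k + 1).+1)%N by lia.
    by rewrite PuS addrA.
  case: eqP => [js'|js'].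
    rewrite ifT; last by lia.
    have -> : (j.+1 - s + 1 = k.-1.+1)%N by lia.
    have -> : (j - k + 1 = s.-1)%N by lia.
    have -> : Pu s = Pu s.-1 + coord u s by rewrite -[in LHS](prednK (_ : 0 < s)%N) ?PuS ?prednK//; lia.
    by rewrite PtS prednK//; lra.
  rewrite ifF; last by lia.
  have -> : (j.+1 - s + 1 = (j - s + 1).+1)%N by lia.
  by rewrite PtS; lra.
have Pt0 : Pt 0%N = 0 by rewrite /Pt big_geq.
have Ptk j : (j <= r)%N -> Pt j <= j%:R.
  case: j => [|j] jr; first by rewrite Pt0.
  by have := tk j.+1 ltac:(lia); rewrite -/(Pt _); lra.
apply/associahedronP => //; split.
- rewrite cv /v; last by lia.
  case: ifP => [//|k1']; have -> : k = 1%N by lia.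
  by rewrite ifT//; lia.
- move=> j jn; rewrite cv// /v.
  case: ifP => jk; first by apply: t0; lia.
  case: ifP => js; first by apply: u0; lia.
  case: ifP => jks; first by apply: addr_ge0; [apply: u0|apply: t0]; lia.
  by apply: t0; lia.
- move=> j jn; rewrite S; last by lia.
  rewrite /Pv; case: ifP => jk; first by apply: tk; lia.
  case: ifP => js.
    have := uk (j - k + 1)%N ltac:(lia); rewrite -/(Pu _).
    have := Ptk k.-1 ltac:(lia).
    have -> : j%:R = k.-1%:R + (j - k + 1)%:R :> R.
      by rewrite -natrD; congr (_%:R); lia.
    by lra.
  have := tk (j - s + 1)%N ltac:(lia); rewrite -/(Pt _).
  move: us; rewrite -/(Pu _) => ->.
  have -> : j%:R = (j - s + 1)%:R + s%:R - 1 :> R.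
    by rewrite -natrD -[X in _ - X](mulr1n 1) -natrB; [congr (_%:R); lia|lia].
  by lra.
- rewrite S// /Pv !ifF; [|lia|lia].
  have -> : (n - s + 1 = r)%N by lia.
  move: tr us; rewrite -/(Pt _) -/(Pu _) => -> ->.
  have -> : n%:R = r%:R + s%:R - 1 :> R.
    by rewrite -natrD rsn -natr1 addrK.
  by lra.
Qed.

End associahedra.

Section cubic_complex.
Variable R : realType.
Implicit Types n r s k : nat.

Record cell n := Cell {
  cell_set :> set 'rV[R]_n ;
  cell_dim : nat ;
  cell_param : 'rV[R]_cell_dim -> 'rV[R]_n ;
  cell_param_in : forall z, cell_set (cell_param z) ;
  cell_param_onto : forall x, cell_set x -> exists z, cell_param z = x
}.
Arguments cell_param {n} c z.
Arguments cell_param_in {n} c z.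
Arguments cell_param_onto {n} c x.

Lemma pi_set_itv (t : R) : 0 <= pi_set t <= 1.
Proof.
by rewrite /pi_set le_max lexx/= ge_max ler01 ge_min lexx.
Qed.

Lemma pi_set_id (t : R) : 0 <= t <= 1 -> pi_set t = t.
Proof. by move=> /andP[t0 t1]; rewrite /pi_set min_r// max_r. Qed.

Program Definition point_cell n (b : 'rV[R]_n) : cell n :=
  @Cell n [set b] 0 (fun=> b) _ _.
Next Obligation. by []. Qed.
Next Obligation. by move=> n b x ->; exists 0. Qed.

Program Definition face_cell r s n k (rho : cell r) (kappa : cell s) : cell n :=
  @Cell n [set face n k x y | x in rho & y in kappa]
    (cell_dim rho + cell_dim kappa)
    (fun z => face n k (cell_param rho (lsubmx z)) (cell_param kappa (rsubmx z)))
    _ _.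
Next Obligation.
move=> r s n k rho kappa z.
exists (cell_param rho (lsubmx z)); first exact: cell_param_in.
by exists (cell_param kappa (rsubmx z)); first exact: cell_param_in.
Qed.
Next Obligation.
move=> r s n k rho kappa _ [x /cell_param_onto[a <-]] [y /cell_param_onto[b <-]] <-.
by exists (row_mx a b); rewrite row_mxKl row_mxKr.
Qed.

Program Definition join_cell n (sigma : cell n) (b : 'rV[R]_n) : cell n :=
  @Cell n [set (1 - t) *: x + t *: b | x in sigma & t in [set t | 0 <= t <= 1]]
    (cell_dim sigma + 1)
    (fun z => let t := pi_set (rsubmx z 0 0) in
              (1 - t) *: cell_param sigma (lsubmx z) + t *: b)
    _ _.
Next Obligation.
move=> n sigma b z; exists (cell_param sigma (lsubmx z)).
  exact: cell_param_in.
by exists (pi_set (rsubmx z 0 0)) => //; exact: pi_set_itv.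
Qed.
Next Obligation.
move=> n sigma b _ [x /cell_param_onto[a <-]] [t t01 <-].
exists (row_mx a (const_mx t)).
by rewrite row_mxKl row_mxKr mxE pi_set_id.
Qed.

(* The nonempty cells of K(n); the empty cell is left out, its inclusion being
   smooth for every diffeology.  A cell obtained from several families
   (r, s, k, rho, kappa) occurs once with each of its parametrizations; they
   differ by a permutation of the coordinates of R^q. *)
Inductive cubic_cell : forall n, cell n -> Prop :=
| cubic_base n : (2 <= n)%N -> cubic_cell (point_cell (base_point R n))
| cubic_face r s n k (rho : cell r) (kappa : cell s) : face_index r s n k ->
    cubic_cell rho -> cubic_cell kappa -> cubic_cell (face_cell n k rho kappa)
| cubic_join r s n k (rho : cell r) (kappa : cell s) : face_index r s n k ->
    cubic_cell rho -> cubic_cell kappa ->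
    cubic_cell (join_cell (face_cell n k rho kappa) (base_point R n)).

Lemma face_index_ge2 r s n k : face_index r s n k ->
  [/\ (2 <= r)%N, (2 <= s)%N & (2 <= n)%N].
Proof. by rewrite /face_index; split; lia. Qed.

Lemma cubic_cell_sub n (sigma : cell n) :
  cubic_cell sigma -> sigma `<=` @associahedron R n.
Proof.
elim=> {n sigma} [n n2|r s n k rho kappa H _ IHr _ IHk|r s n k rho kappa H _ IHr _ IHk].
- by move=> _ ->; exact: base_point_in.
- by move=> _ [x rx] [y ky] <-; apply: face_in H _ _; [exact: IHr|exact: IHk].
- move=> _ [_ [x rx] [y ky <-]] [t t01 <-]; have [_ _ n2] := face_index_ge2 H.
  apply: associahedron_convex => //; last exact: base_point_in.
  by apply: face_in H _ _; [exact: IHr|exact: IHk].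
Qed.

Definition cell_proj n (sigma : cell n) (z : euclidean R (cell_dim sigma)) :
  {x | cell_set sigma x} := exist _ (cell_param sigma z) (cell_param_in sigma z).

Definition cellSpace n (sigma : cell n) : diffSpace R :=
  DiffSpace (pushforward_diffeology (@cell_proj n sigma)).

Definition cell_incl n (sigma : {sigma : cell n | cubic_cell sigma})
    (x : cellSpace (sval sigma)) : {t : 'rV[R]_n | associahedron t} :=
  exist _ (sval x) (cubic_cell_sub (svalP sigma) (svalP x)).

(* |K(n)|: in general not the subspace diffeology of R^n, since the
   parametrizations of the cells are only piecewise smooth. *)
Definition complexSpace n : diffSpace R :=
  DiffSpace (final_diffeology (@cell_incl n)).

Definition complex_base n (n2 : (2 <= n)%N) : complexSpace n :=
  exist _ (base_point R n) (base_point_in R n2).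

Definition complex_face r s n k (H : face_index r s n k)
    (rho : complexSpace r) (kappa : complexSpace s) : complexSpace n :=
  exist _ (face n k (sval rho) (sval kappa)) (face_in H (svalP rho) (svalP kappa)).

End cubic_complex.

Section internal_categories.
Variables (R : realType) (G X : diffSpace R).
Variables (sigma tau : G -> X) (iota : X -> G).
Implicit Types n r s k : nat.

Record precategory : Prop := Precategory {
  pre_src : smooth sigma ;
  pre_tgt : smooth tau ;
  pre_unit : smooth iota ;
  pre_src_unit : forall x, sigma (iota x) = x ;
  pre_tgt_unit : forall x, tau (iota x) = x
}.

Definition composable n : set (powerSpace G n) :=
  [set g | forall i j : 'I_n, j = i.+1 :> nat -> tau (g i) = sigma (g j)].

Definition chainSpace n : diffSpace R := subSpace (@composable n).

Definition first_ord n (n2 : (2 <= n)%N) : 'I_n := Ordinal (ltnW n2).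

Lemma last_ord_subproof n : (2 <= n)%N -> (n.-1 < n)%N.
Proof. by case: n. Qed.

Definition last_ord n (n2 : (2 <= n)%N) : 'I_n := Ordinal (last_ord_subproof n2).

Section substitution.
Variables (r s n k : nat) (H : face_index r s n k).

Lemma fi_r : (2 <= r)%N. Proof. by have [] := face_index_ge2 H. Qed.
Lemma fi_s : (2 <= s)%N. Proof. by have [] := face_index_ge2 H. Qed.
Lemma fi_n : (2 <= n)%N. Proof. by have [] := face_index_ge2 H. Qed.

Lemma seg_ord_subproof (i : 'I_s) : (k.-1 + i < n)%N.
Proof. by have := ltn_ord i; move: H; rewrite /face_index; lia. Qed.

Definition seg_ord (i : 'I_s) : 'I_n := Ordinal (seg_ord_subproof i).

Lemma left_ord_subproof (i : 'I_r) : (i < n)%N.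
Proof. by have := ltn_ord i; move: H; rewrite /face_index; lia. Qed.

Definition left_ord (i : 'I_r) : 'I_n := Ordinal (left_ord_subproof i).

Lemma right_ord_subproof (i : 'I_r) : (i + s - 1 < n)%N.
Proof. by have := ltn_ord i; move: H; rewrite /face_index; lia. Qed.

Definition right_ord (i : 'I_r) : 'I_n := Ordinal (right_ord_subproof i).

(* (g_k, ..., g_{k+s-1}); k is counted from 1, the ordinals from 0. *)
Definition segment_fun (g : chainSpace n) : 'I_s -> G :=
  fun i => sval g (seg_ord i).

Lemma segment_composable g : composable (segment_fun g).
Proof. by move=> i j ij; apply: (svalP g); rewrite /= ij addnS. Qed.

Definition segment (g : chainSpace n) : chainSpace s :=
  exist _ (segment_fun g) (segment_composable g).

(* (g_1, ..., g_{k-1}, h, g_{k+s}, ..., g_n) *)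
Definition substitute_fun (g : chainSpace n) (h : G) : 'I_r -> G :=
  fun i => if (i.+1 < k)%N then sval g (left_ord i)
           else if i.+1 == k then h else sval g (right_ord i).

Lemma substitute_composable (g : chainSpace n) (h : G) :
  sigma h = sigma (sval (segment g) (first_ord fi_s)) ->
  tau h = tau (sval (segment g) (last_ord fi_s)) ->
  composable (substitute_fun g h).
Proof.
move=> sh th i j ij; rewrite /substitute_fun ij.
have Hk := H; rewrite /face_index in Hk.
have jr := ltn_ord j; have s2 := fi_s.
have [ik|ik] := ltnP i.+1 k.
  have [ik'|ik'] := ltnP i.+2 k; first by apply: (svalP g).
  rewrite ifT; last by lia.
  by rewrite sh; apply: (svalP g) => /=; lia.
rewrite (_ : (i.+2 < k)%N = false); last by lia.
rewrite (_ : (i.+2 == k) = false); last by lia.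
case: eqP => ik'.
  by rewrite th; apply: (svalP g) => /=; lia.
by apply: (svalP g) => /=; lia.
Qed.

Definition substitute (g : chainSpace n) (h : G)
    (sh : sigma h = sigma (sval (segment g) (first_ord fi_s)))
    (th : tau h = tau (sval (segment g) (last_ord fi_s))) : chainSpace r :=
  exist _ (substitute_fun g h) (substitute_composable sh th).

End substitution.

Definition chain2_fun (g h : G) : 'I_2 -> G :=
  fun i => if i == 0 :> nat then g else h.

Lemma chain2_composable (g h : G) :
  tau g = sigma h -> composable (chain2_fun g h).
Proof.
move=> gh i j ij; have := ltn_ord j; rewrite /chain2_fun ij /= => i0.
by rewrite ifT//; lia.
Qed.

Definition chain2 (g h : G) (gh : tau g = sigma h) : chainSpace 2 :=
  exist _ (chain2_fun g h) (chain2_composable gh).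

Record A_infty_form := AInftyForm {
  mul : forall n, (2 <= n)%N -> prodSpace (complexSpace R n) (chainSpace n) -> G ;
  mul_smooth : forall n (n2 : (2 <= n)%N), smooth (mul n2) ;
  mul_src : forall n (n2 : (2 <= n)%N) (a : complexSpace R n) (g : chainSpace n),
    sigma (mul n2 (a, g)) = sigma (sval g (first_ord n2)) ;
  mul_tgt : forall n (n2 : (2 <= n)%N) (a : complexSpace R n) (g : chainSpace n),
    tau (mul n2 (a, g)) = tau (sval g (last_ord n2)) ;
  mul_face : forall r s n k (H : face_index r s n k)
      (rho : complexSpace R r) (kappa : complexSpace R s) (g : chainSpace n),
    mul (fi_n H) (complex_face H rho kappa, g) =
    mul (fi_r H) (rho, substitute (mul_src (fi_s H) kappa (segment H g))
                                  (mul_tgt (fi_s H) kappa (segment H g)))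
}.

Definition base2 : complexSpace R 2 := complex_base R (leqnn 2).

Definition left_unit_mul (M : A_infty_form) (pre : precategory) (g : G) : G :=
  mul M (leqnn 2) (base2, chain2 (pre_tgt_unit pre (sigma g))).

Definition right_unit_mul (M : A_infty_form) (pre : precategory) (g : G) : G :=
  mul M (leqnn 2) (base2, chain2 (esym (pre_src_unit pre (tau g)))).

Definition h_unital_A_infty_category : Prop :=
  exists (pre : precategory) (M : A_infty_form),
    smoothly_homotopic (left_unit_mul M pre) id /\
    smoothly_homotopic (right_unit_mul M pre) id.

End internal_categories.

(* Main.v *)
Require Import Defs.
From mathcomp Require Import all_boot all_order all_algebra.
From mathcomp Require Import all_classical all_reals all_analysis.
From mathcomp Require Import zify ring lra.

(** The product M(n)(a; u_1, ..., u_n) is the concatenation of the n paths in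
    which u_i runs through an interval of length l_i(a), where the positive
    lengths l_1(a), ..., l_n(a) have sum 1.  The theorem then splits into a
    statement about lengths and a statement about concatenations.

    Lengths.  The face equations hold as soon as the length functions turn the
    face operators of the associahedra into the partial compositions of
    subdivisions of [0, 1]: l_(k-1+i)(face(rho, kappa)) =
    l_k(rho) * l_i(kappa) inside the inserted block, and the lengths of rho
    elsewhere.  This prescribes the lengths on the boundary of K_n by induction
    on n; they are extended over the cone with apex b_n by
    l((1 - t) x + t b_n) = (1 - s(t)) l(x) + s(t) / n, where s is a smooth step,
    constant outside [0, 1].  As s o pi_set = s, the lengths become smooth when
    composed with the parametrization of any cell (cell_lens), whereas pi_set
    itself is not smooth.

    The lengths have to be well defined: a boundary point can lie on several
    faces.  In the coordinates e_i = i - (t_1 + ... + t_i), 0 <= i < n, the face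
    operators become partial compositions for addition, just as the lengths
    compose by multiplication, so both sides obey the same two associativity
    laws (insert_nested, insert_disjoint).  The face L_k(r, s) is described by
    inequalities on e (block), from which the intervals [k, k + s - 1] of two
    faces with a common point are nested or disjoint (block_laminar); an
    associativity law then reduces the comparison of the two formulas to
    smaller n.  Moreover a point different from b_n has a unique coordinate t and
    lies on a cone over a boundary point (cone_param_uniq, cone_exists).  The
    lengths are therefore introduced as a relation lens, which is shown to be
    total (lens_total) and functional (lens_functional).

    Concatenation.  A path u_i is constant on each side of [0, 1], so for every
    real function phi on X the concatenation satisfies, without any case
    distinction on t,
      phi (M(a; u)(t)) = phi (u_1 (0)) +
        sum_i (phi (u_i ((t - p_i) / l_i)) - phi (u_i (0))),
    where p_i is the sum of the lengths before l_i (concat_telescope).  For a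
    smooth phi the right-hand side depends smoothly on all the data, and
    reflexivity of X gives the smoothness of M(n) (concat_plot).  The face
    equations follow because both sides run through the same paths on the same
    intervals (is_concat_uniq).

    Units.  A product with a constant path is a reparametrization
    u (c t + b) of u with c = 2; letting c decrease to 1 gives the
    homotopies to the identity (reparam_homotopic). *)

Set Implicit Arguments.
Unset Strict Implicit.
Unset Printing Implicit Defensive.

(* This makes coord the coordinate function on K_n again, hidden above by the
   coordinates in a basis of a vector space. *)
Import Defs.
Import Order.TTheory GRing.Theory Num.Theory.
Import numFieldNormedType.Exports.

Local Open Scope classical_set_scope.
Local Open Scope ring_scope.

(** * Smooth real functions and a smooth step *)

Section smooth_functions.
Variable R : realType.
Implicit Types (m n k : nat).

Lemma CkV m k (U : set 'rV[R]_m) (f : 'rV[R]_m -> R) :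
  open U -> (forall x, U x -> f x != 0) -> Ck k U f ->
  Ck k U (fun x => (f x)^-1).
Proof.
move=> oU f0; elim: k => [|k IH] Cf.
  by move=> x Ux; apply: continuousV; [exact: f0|exact: Cf].
have [df Df] := Cf; split=> [x Ux|i].
  by apply: differentiableV; [exact: df|exact: f0].
have Cv := IH (CkS Cf).
have := CkM oU (@Ck_cst R m k U (-1)) (CkM oU (CkM oU Cv Cv) (Df i)).
apply: Ck_ext => // x Ux.
rewrite deriveV ?f0//; last exact: diff_derivable (df _ Ux).
rewrite mulN1r scaleNr -expr2 exprVn. by [].
Qed.

Lemma smooth_on_cst m (U : set 'rV[R]_m) (c : R) : smooth_on U (fun=> c).
Proof. by move=> k; exact: Ck_cst. Qed.

Lemma smooth_onD m (U : set 'rV[R]_m) (f g : 'rV[R]_m -> R) : open U ->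
  smooth_on U f -> smooth_on U g -> smooth_on U (fun x => f x + g x).
Proof. by move=> oU sf sg k; exact: CkD. Qed.

Lemma smooth_onM m (U : set 'rV[R]_m) (f g : 'rV[R]_m -> R) : open U ->
  smooth_on U f -> smooth_on U g -> smooth_on U (fun x => f x * g x).
Proof. by move=> oU sf sg k; exact: CkM. Qed.

Lemma smooth_onB m (U : set 'rV[R]_m) (f g : 'rV[R]_m -> R) : open U ->
  smooth_on U f -> smooth_on U g -> smooth_on U (fun x => f x - g x).
Proof.
move=> oU sf sg k.
have := CkD oU (sf k) (CkM oU (@Ck_cst R m k U (-1)) (sg k)).
by apply: Ck_ext => // x _; rewrite mulN1r.
Qed.

Lemma smooth_onV m (U : set 'rV[R]_m) (f : 'rV[R]_m -> R) : open U ->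
  (forall x, U x -> f x != 0) -> smooth_on U f ->
  smooth_on U (fun x => (f x)^-1).
Proof. by move=> oU f0 sf k; exact: CkV. Qed.

Lemma smooth_on_sum m (I : Type) (r : seq I) (U : set 'rV[R]_m)
    (f : I -> 'rV[R]_m -> R) : open U -> (forall i, smooth_on U (f i)) ->
  smooth_on U (fun x => \sum_(i <- r) f i x).
Proof. by move=> oU sf k; apply: Ck_sum => // i; exact: sf. Qed.

(** A class of functions closed under derivation consists of smooth functions:
    this is the form in which smoothness of a flat function is accessible, its
    derivatives of all orders being treated at once. *)
Lemma smooth_on_derivable_class (S : (R -> R) -> Prop) :
  (forall f, S f -> exists2 f', S f' & forall x, is_derive x (1 : R) f (f' x)) ->
  forall f, S f -> forall m (U : set 'rV[R]_m) (q : 'rV[R]_m -> R),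
  open U -> smooth_on U q -> smooth_on U (fun x => f (q x)).
Proof.
move=> Sd f Sf m U q oU sq k.
have C : Ck k setT (fun x : 'rV[R]_1 => f (x 0 0)).
  elim: k f Sf => [|k IH] f Sf; have [f' Sf' df] := Sd f Sf;
    have dff y : differentiable f y
      by apply/derivable1_diffP; exact: (@ex_derive _ _ _ _ _ _ _ (df y)).
    move=> x _; apply: (@continuous_comp _ _ _ (fun x : 'rV[R]_1 => x 0 0) f).
      exact: coord_continuous.
    exact: differentiable_continuous.
  split=> [x _|i].
    apply: (@differentiable_comp R _ _ _ (fun x : 'rV[R]_1 => x 0 0) f) => //.
    exact: differentiable_coord.
  rewrite (_ : (fun x => _) = fun x : 'rV[R]_1 => f' (x 0 0)); first exact: IH.
  apply/funext => x; have <- := @derive_val _ _ _ _ _ _ _ (df (x 0 0)).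
  rewrite /derive; apply: (congr1 (fun F : R -> R => lim (F @ 0^'))).
  by apply/funext => h /=; rewrite !mxE (ord1 i) eqxx.
have D : Ck k U (fun x => (const_mx (q x) : 'rV[R]_1) 0 0).
  by apply: Ck_ext (sq k) => // x _; rewrite mxE.
have := @Ck_comp R m 1 k setT U _ (fun x => const_mx (q x)) oU (fun _ _ => I) _ C.
move=> H; apply: Ck_ext (H _) => // [x _|j]; first by rewrite mxE.
by rewrite (ord1 j).
Qed.

(** The derivatives of exp(-1/x), extended by 0 to x <= 0, all have this form. *)
Definition psi (p : {poly R}) (x : R) : R :=
  if 0 < x then p.[x^-1] * expR (- x^-1) else 0.

(** The rate a is arbitrary so that the induction can spend half of it on the
    factor 'X. *)
Lemma horner_le_expR (p : {poly R}) (a : R) : 0 < a ->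
  exists C : R, forall y, 0 <= y -> `|p.[y]| <= C * expR (a * y).
Proof.
elim/poly_ind: p a => [|p c IH] a a0.
  by exists 0 => y y0; rewrite horner0 normr0 mul0r.
have a20 : 0 < a / 2 by rewrite divr_gt0.
have [C HC] := IH _ a20.
exists (C / (a / 2) + `|c|) => y y0.
rewrite hornerMXaddC (le_trans (ler_normD _ _))// mulrDl lerD//.
  have e2 : expR (a * y) = expR (a / 2 * y) * expR (a / 2 * y).
    by rewrite -expRD; congr expR; field.
  rewrite normrM (ger0_norm y0) e2 mulrACA; apply: ler_pM => //; first exact: HC.
  rewrite mulrC ler_pdivlMr// mulrC; have := expR_ge1Dx (a / 2 * y); lra.
by rewrite ler_peMr// -expR0 ler_expR mulr_ge0// ltW.
Qed.

(** The bound is quadratic so that psi p is both continuous and derivable at 0. *)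
Lemma psi_flat (p : {poly R}) : exists C : R, forall h, `|psi p h| <= C * h ^+ 2.
Proof.
have [C HC] := @horner_le_expR (p * 'X^2) 1 ltr01.
exists C => h; rewrite /psi; case: ifP => h0; last first.
  have C0 : 0 <= C.
    by have := HC 0 (lexx _); rewrite mulr0 expR0 mulr1; apply: le_trans.
  by rewrite normr0 mulr_ge0// sqr_ge0.
have hi0 : 0 < h^-1 by rewrite invr_gt0.
have := HC _ (ltW hi0); rewrite hornerM hornerXn mul1r.
rewrite 2!(normrM p.[h^-1]) (ger0_norm (expR_ge0 _)).
rewrite (ger0_norm (exprn_ge0 _ (ltW hi0))).
rewrite expRN ler_pdivrMr ?expR_gt0// => H.
rewrite -(@ler_pM2r _ (h^-1 ^+ 2)) ?exprn_gt0//; apply: le_trans H _.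
by rewrite -mulrA mulrAC [X in _ <= X](_ : _ = C * expR h^-1)//;
  field; rewrite gt_eqF.
Qed.

Lemma psi_continuous0 (p : {poly R}) : {for 0, continuous (psi p)}.
Proof.
have [C HC] := psi_flat p.
have p0 : psi p 0 = 0 by rewrite /psi ltxx.
rewrite /prop_for /continuous_at p0.
apply: (@squeeze_cvgr _ _ _ _ (fun h => - (C * h ^+ 2)) (fun h => C * h ^+ 2)).
- by near=> h; have := HC h; rewrite ler_norml.
- have : - (C * h ^+ 2) @[h --> 0] --> - (C * 0 ^+ 2).
    apply: cvgN; apply: cvgM; first exact: cvg_cst.
    exact: exprn_continuous.
  by rewrite expr0n/= mulr0 oppr0.
- have : (C * h ^+ 2) @[h --> 0] --> (C * 0 ^+ 2).
    apply: cvgM; first exact: cvg_cst.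
    exact: exprn_continuous.
  by rewrite expr0n/= mulr0.
Unshelve. all: by end_near. Qed.

(** At 0 the slope of psi p is psi (p * 'X), which tends to 0. *)
Lemma is_derive_psi (p : {poly R}) (x : R) :
  is_derive x (1 : R) (psi p) (psi ('X^2 * (p - p^`())) x).
Proof.
have [x0|x0|<-] := ltgtP 0 x.
- apply: (@near_eq_is_derive R R R (fun y : R => p.[y^-1] * expR (- y^-1)) (psi p) x 1).
    near=> y; rewrite /psi ifT//; near: y; exact: lt_nbhsr.
  have xn0 : x != 0 by rewrite gt_eqF.
  have dV : is_derive x (1 : R) (fun y : R => y^-1) (- x ^- 2 *: 1).
    by apply: is_deriveV.
  have dp := @is_derive1_comp R (horner p) (fun y => y^-1) x _ _
    (is_derive_poly p x^-1) dV.
  have dN : is_derive x (1 : R) (fun y : R => - y^-1) (- (- x ^- 2 *: 1)).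
    exact: is_deriveN.
  have de := @is_derive1_comp R expR (fun y => - y^-1) x _ _
    (is_derive_expR (- x^-1)) dN.
  refine (@is_derive_eq R R R _ x 1 _ _ (is_deriveM dp de) _).
  rewrite /psi x0 /= !hornerE /GRing.scale /= !exprVn; ring.
- apply: (@near_eq_is_derive R R R (cst 0) (psi p) x 1).
    near=> y; rewrite /psi ifF//; apply/negbTE; rewrite -leNgt ltW//.
    near: y; exact: lt_nbhsl.
  by rewrite /psi ifF; [exact: is_derive_cst|apply/negbTE; rewrite -leNgt ltW].
- apply/is_derive1_caratheodory; exists (psi (p * 'X)); split.
  + move=> z; rewrite /psi ltxx !subr0; case: ifP => [z0|_]; last by rewrite mul0r.
    by rewrite hornerM hornerX; field; rewrite gt_eqF.
  + exact: psi_continuous0.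
  + by rewrite /psi ltxx.
Unshelve. all: by end_near. Qed.

Lemma smooth_on_psi (p : {poly R}) m (U : set 'rV[R]_m) (q : 'rV[R]_m -> R) :
  open U -> smooth_on U q -> smooth_on U (fun x => psi p (q x)).
Proof.
move=> oU sq.
apply: (@smooth_on_derivable_class (fun f => exists p, f = psi p)) => //.
  move=> _ [{}p ->]; exists (psi ('X^2 * (p - p^`()))); last exact: is_derive_psi.
  by exists ('X^2 * (p - p^`())).
by exists p.
Qed.

Definition smooth_step (x : R) : R := psi 1 x / (psi 1 x + psi 1 (1 - x)).

Lemma psi1_ge0 x : 0 <= psi 1 x.
Proof. by rewrite /psi; case: ifP => // _; rewrite hornerE mul1r expR_ge0. Qed.

Lemma psi1_gt0 x : 0 < x -> 0 < psi 1 x.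
Proof. by rewrite /psi => ->; rewrite hornerE mul1r expR_gt0. Qed.

Lemma psi1_denom x : 0 < psi 1 x + psi 1 (1 - x).
Proof.
have [x0|x0] := ltP 0 x; first by rewrite ltr_pwDl ?psi1_gt0 ?psi1_ge0.
by rewrite ltr_wpDl ?psi1_ge0 ?psi1_gt0//; lra.
Qed.

Lemma smooth_on_step m (U : set 'rV[R]_m) (q : 'rV[R]_m -> R) :
  open U -> smooth_on U q -> smooth_on U (fun x => smooth_step (q x)).
Proof.
move=> oU sq; apply: smooth_onM => //; first exact: smooth_on_psi.
apply: smooth_onV => // [x _|]; first by rewrite gt_eqF ?psi1_denom.
apply: smooth_onD => //; apply: smooth_on_psi => //.
by apply: smooth_onB => //; exact: smooth_on_cst.
Qed.

Lemma smooth_step0 x : x <= 0 -> smooth_step x = 0.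
Proof. by rewrite leNgt => /negbTE x0; rewrite /smooth_step /psi x0 mul0r. Qed.

Lemma smooth_step1 x : 1 <= x -> smooth_step x = 1.
Proof.
move=> x1; rewrite /smooth_step; have := psi1_denom x.
rewrite [psi 1 (1 - x)]/psi ifF; last by apply/negbTE; rewrite -leNgt; lra.
by rewrite addr0 => ?; rewrite divff// gt_eqF.
Qed.

Lemma smooth_step_itv x : 0 <= smooth_step x <= 1.
Proof.
rewrite /smooth_step divr_ge0 ?psi1_ge0 ?(ltW (psi1_denom _))//=.
by rewrite ler_pdivrMr ?psi1_denom// mul1r lerDl psi1_ge0.
Qed.

Lemma pi_set_le0 (x : R) : x <= 0 -> pi_set x = 0.
Proof. by move=> x0; rewrite /pi_set min_r ?max_l//; lra. Qed.

Lemma pi_set_ge1 (x : R) : 1 <= x -> pi_set x = 1.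
Proof. by move=> x1; rewrite /pi_set min_l// max_r//; lra. Qed.

(** This is what reconciles the merely continuous parametrizations of the cells
    with smoothness: the coordinate pi_set t of a cone enters the lengths only
    through the smooth function smooth_step t. *)
Lemma smooth_step_pi_set x : smooth_step (pi_set x) = smooth_step x.
Proof.
have [x0|x0] := leP x 0; first by rewrite pi_set_le0// !smooth_step0.
have [x1|x1] := leP 1 x; first by rewrite pi_set_ge1// !smooth_step1.
by rewrite pi_set_id// !ltW.
Qed.

End smooth_functions.

(** * Partial compositions *)

Section insertion.
Variable T : Type.
Implicit Types (n r s a : nat) (op : T -> T -> T) (f g h : nat -> T).

(** The partial composition of nonsymmetric operads: g, of arity s, is inserted
    at the position a of f, counted from 0.  With op = +%R it describes the face
    operators in the coordinates below, and with op = *%R the composition of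
    subdivisions of an interval.  Only the values at positions smaller than the
    arity are meaningful. *)
Definition insert op a s f g (i : nat) : T :=
  if (i < a)%N then f i
  else if (i < a + s)%N then op (f a) (g (i - a)%N)
  else f (i - s + 1)%N.

Lemma eq_insert op r s n a f f' g g' : (0 < s)%N -> (r + s = n.+1)%N -> (a < r)%N ->
  (forall i, (i < r)%N -> f i = f' i) -> (forall i, (i < s)%N -> g i = g' i) ->
  forall i, (i < n)%N -> insert op a s f g i = insert op a s f' g' i.
Proof.
move=> s0 rsn ar ff gg i ni; rewrite /insert.
case: ifP => ia; first by apply: ff; lia.
case: ifP => ias; first by congr op; [apply: ff|apply: gg; lia].
by apply: ff; lia.
Qed.

(** Sequential associativity in an operad. *)
Lemma insert_nested op : associative op -> forall a b s t f g h i,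
  (0 < s)%N -> (0 < t)%N -> (b < s)%N ->
  insert op a (s + t - 1) f (insert op b t g h) i =
  insert op (a + b) t (insert op a s f g) h i.
Proof.
move=> opA a b s t f g h i s0 t0 bs; rewrite /insert.
have [ia|ia] := ltnP i a; first by rewrite ifT//; lia.
have [iab|iab] := ltnP i (a + b).
  have -> : (i < a + (s + t - 1))%N = true by lia.
  have -> : (i - a < b)%N = true by lia.
  by rewrite ifT//; lia.
have [iabt|iabt] := ltnP i (a + b + t).
  have -> : (i < a + (s + t - 1))%N = true by lia.
  have -> : (i - a < b)%N = false by lia.
  have -> : (i - a < b + t)%N = true by lia.
  have -> : (a + b < a)%N = false by lia.
  have -> : (a + b < a + s)%N = true by lia.
  rewrite opA; congr (op (op _ (g _)) (h _)); lia.
have -> : (i - t + 1 < a)%N = false by lia.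
have [iast|iast] := ltnP i (a + (s + t - 1)).
  have -> : (i - a < b)%N = false by lia.
  have -> : (i - a < b + t)%N = false by lia.
  have -> : (i - t + 1 < a + s)%N = true by lia.
  congr (op _ (g _)); lia.
have -> : (i - t + 1 < a + s)%N = false by lia.
congr f; lia.
Qed.

(** Parallel associativity in an operad. *)
Lemma insert_disjoint op a b s t f g h i :
  (0 < s)%N -> (0 < t)%N -> (a < b)%N ->
  insert op a s (insert op b t f h) g i =
  insert op (b + s - 1) t (insert op a s f g) h i.
Proof.
move=> s0 t0 ab; rewrite /insert.
have -> : (a < b)%N by [].
have [ia|ia] := ltnP i a.
  have -> : (i < b)%N by lia.
  by rewrite ifT//; lia.
have [ias|ias] := ltnP i (a + s).
  by rewrite ifT//; lia.
have -> : (b + s - 1 < a)%N = false by lia.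
have -> : (b + s - 1 < a + s)%N = false by lia.
have [ib|ib] := ltnP (i - s + 1) b; first by rewrite ifT//; lia.
have -> : (i < b + s - 1)%N = false by lia.
have [ibt|ibt] := ltnP (i - s + 1) (b + t).
  rewrite ifT; last by lia.
  congr (op (f _) (h _)); lia.
rewrite ifF; last by lia.
have -> : (i - t + 1 < a)%N = false by lia.
have -> : (i - t + 1 < a + s)%N = false by lia.
congr f; lia.
Qed.

End insertion.

(** * Subdivisions attached to the points of the associahedra *)

Section heights.
Variable R : realType.
Implicit Types (n r s a k : nat) (e f g h l : nat -> R).

(** K_n in the coordinates e_i = i - (t_1 + ... + t_i) for 0 <= i < n.  At a
    vertex of K_n, i.e. a binary tree, e_i is the number of subtrees that hang on
    the left of the path from the root to the leaf i, which explains why heights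
    add up when trees are grafted. *)
Definition heights n e : Prop :=
  [/\ e 0%N = 0, e 1%N = 1, forall i, (0 < i < n)%N -> 1 <= e i &
      forall i, (i.+1 < n)%N -> e i.+1 <= e i + 1].

(** The heights of the base point b_n, whatever n is. *)
Definition corolla (i : nat) : R := if i == 0%N then 0 else i.+1%:R / 2.

Lemma eq_heights n e f : (2 <= n)%N -> (forall i, (i < n)%N -> e i = f i) ->
  heights n e -> heights n f.
Proof.
move=> n2 ef [e0 e1 eg es]; split.
- by rewrite -ef//; lia.
- by rewrite -ef//; lia.
- by move=> i ni; rewrite -ef; [apply: eg|lia].
- by move=> i ni; rewrite -!ef//; [apply: es|lia].
Qed.

Lemma heights_ge0 n e i : heights n e -> (i < n)%N -> 0 <= e i.
Proof.
case: i => [|i] [e0 e1 eg es] ni; first by rewrite e0.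
by rewrite (le_trans ler01)// eg.
Qed.

Lemma corolla_heights n : heights n corolla.
Proof.
rewrite /corolla; split=> //=; first by rewrite divff.
- case=> // i _; rewrite ler_pdivlMr// mul1r ler_nat; lia.
- case=> [|i] _ /=; first by lra.
  by rewrite -[i.+3%:R]natr1; set x := i.+2%:R; lra.
Qed.

Lemma heights_insert r s n a e1 e2 : (2 <= r)%N -> (2 <= s)%N ->
  (r + s = n.+1)%N -> (a < r)%N -> heights r e1 -> heights s e2 ->
  heights n (insert +%R a s e1 e2).
Proof.
move=> r2 s2 rsn ar H1 H2; have [a0 a1 ag as_] := H1; have [b0 b1 bg bs] := H2.
have a_ge0 i : (i < r)%N -> 0 <= e1 i by exact: heights_ge0 H1.
have b_ge0 i : (i < s)%N -> 0 <= e2 i by exact: heights_ge0 H2.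
rewrite /insert; split.
- case: ifP => // a0'; have -> : a = 0%N by lia.
  by rewrite ifT ?subnn ?a0 ?b0 ?addr0//; lia.
- case: ifP => // a1'; rewrite ifT; last by lia.
  have [->|a0'] := eqVneq a 0%N; first by rewrite a0 b1 add0r.
  have -> : a = 1%N by lia.
  by rewrite a1 subnn b0 addr0.
- move=> i ni; case: ifP => ia; first by apply: ag; lia.
  case: ifP => ias; last by apply: ag; lia.
  have [iea|ia'] := eqVneq i a; first by rewrite iea subnn b0 addr0 ag//; lia.
  by have := bg (i - a)%N ltac:(lia); have := a_ge0 a ltac:(lia); lra.
- move=> i ni; have [ia|ia] := ltnP i.+1 a.
    by rewrite ifT; [apply: as_; lia|lia].
  have [ia'|ia'] := ltnP i a.
    rewrite ifT; last by lia.
    have -> : a = i.+1 by lia.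
    by rewrite subnn b0 addr0; apply: as_; lia.
  have [ias|ias] := ltnP i.+1 (a + s).
    rewrite ifT; last by lia.
    have -> : (i.+1 - a = (i - a).+1)%N by lia.
    by have := bs (i - a)%N ltac:(lia); lra.
  have [ias'|ias'] := ltnP i (a + s).
    have -> : (i.+1 - s + 1 = a.+1)%N by lia.
    have := as_ a ltac:(lia); have := b_ge0 (i - a)%N ltac:(lia); lra.
  have -> : (i.+1 - s + 1 = (i - s + 1).+1)%N by lia.
  by apply: as_; lia.
Qed.

(** The inequalities that cut the face on which the leaves a, ..., a + s - 1 are
    grouped together out of K_n.  For a + s = n the last one would involve
    e_n = 1 and hold. *)
Definition block n a s e : Prop :=
  [/\ e a.+1 = e a + 1, forall i, (a < i < a + s)%N -> e a + 1 <= e i &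
      (a + s < n)%N -> e (a + s)%N <= e a + 1].

Lemma block_insert r s n a e1 e2 : (2 <= r)%N -> (2 <= s)%N ->
  (r + s = n.+1)%N -> (a < r)%N -> heights r e1 -> heights s e2 ->
  block n a s (insert +%R a s e1 e2).
Proof.
move=> r2 s2 rsn ar [a0 a1 ag as_] [b0 b1 bg bs]; rewrite /block /insert.
have -> : (a < a)%N = false by lia.
have -> : (a < a + s)%N = true by lia.
rewrite subnn b0 addr0; split.
- rewrite ifF; last by lia.
  by rewrite ifT ?subSnn ?b1//; lia.
- move=> i ni; rewrite ifF; last by lia.
  by rewrite ifT ?lerD2l ?bg//; lia.
- move=> ni; rewrite ifF; last by lia.
  rewrite ifF; last by lia.
  rewrite (_ : _ - _ + _ = a.+1)%N; last by lia.
  by apply: as_; lia.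
Qed.

(** outer and inner are the two components of the inverse of the face operator
    on the face given by block. *)
Definition outer a s e i : R := if (i <= a)%N then e i else e (i + s - 1)%N.
Definition inner a e i : R := e (a + i)%N - e a.

Lemma inner0 a e : inner a e 0%N = 0.
Proof. by rewrite /inner addn0 subrr. Qed.

Lemma insert_outer_inner n a s e : (0 < s)%N -> (a + s <= n)%N ->
  forall i, insert +%R a s (outer a s e) (inner a e) i = e i.
Proof.
move=> s0 asn i; rewrite /insert /outer /inner.
have [ia|ia] := ltnP i a; first by rewrite ltnW.
case: ifP => ias; first by rewrite leqnn subnKC// addrC subrK.
rewrite ifF; last by lia.
congr e; lia.
Qed.

Lemma inner_heights n a s e : (2 <= s)%N -> (a + s <= n)%N ->
  heights n e -> block n a s e -> heights s (inner a e).
Proof.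
move=> s2 asn [e0 e1 eg es] [b1 bg be]; rewrite /inner; split.
- by rewrite addn0 subrr.
- by rewrite addn1 b1; lra.
- by move=> i si; have := bg (a + i)%N ltac:(lia); lra.
- by move=> i si; have := es (a + i)%N ltac:(lia); rewrite addnS; lra.
Qed.

Lemma outer_heights r s n a e : (2 <= s)%N -> (2 <= r)%N -> (r + s = n.+1)%N ->
  (a < r)%N -> heights n e -> block n a s e -> heights r (outer a s e).
Proof.
move=> s2 r2 rsn ar [e0 e1 eg es] [b1 bg be]; rewrite /outer; split.
- by [].
- case: ifP => // a1; have a0 : a = 0%N by lia.
  move: be (eg s); rewrite a0 e0 add0r add0n add1n subSS subn0 => be eg'.
  apply/eqP; rewrite eq_le be ?eg'//; lia.
- by move=> i ri; case: ifP => ia; apply: eg; lia.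
- move=> i ri; have [ia|ia] := ltnP i a; first by rewrite ltnW// es//; lia.
  case: ifP => ia'.
    have -> : (i.+1 + s - 1 = a + s)%N by lia.
    have -> : i = a by lia.
    by apply: be; lia.
  have -> : (i.+1 + s - 1 = (i + s - 1).+1)%N by lia.
  by apply: es; lia.
Qed.

(** The face operators are injective, heights starting with e_0 = 0. *)
Lemma insert_add_inj r s n a e1 e2 f1 f2 : (0 < s)%N -> (r + s = n.+1)%N ->
  (a < r)%N -> e2 0%N = 0 -> f2 0%N = 0 ->
  (forall i, (i < n)%N ->
     insert +%R a s e1 e2 i = insert +%R a s f1 f2 i) ->
  (forall i, (i < r)%N -> e1 i = f1 i) /\ (forall i, (i < s)%N -> e2 i = f2 i).
Proof.
move=> s0 rsn ar e0 f0 H.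
have Ha : e1 a = f1 a.
  have na : (a < n)%N by lia.
  have := H a na; rewrite /insert ltnn (_ : (a < a + s)%N = true); last by lia.
  by rewrite subnn e0 f0 !addr0.
split=> i hi.
  have [ia|ia] := ltnP i a.
    by have := H i ltac:(lia); rewrite /insert ia.
  have [->|ia'] := eqVneq i a; first exact: Ha.
  have := H (i + s - 1)%N ltac:(lia); rewrite /insert.
  have -> : (i + s - 1 < a)%N = false by lia.
  have -> : (i + s - 1 < a + s)%N = false by lia.
  by have -> : (i + s - 1 - s + 1 = i)%N by lia.
have := H (a + i)%N ltac:(lia); rewrite /insert.
have -> : (a + i < a)%N = false by lia.
have -> : (a + i < a + s)%N = true by lia.
by rewrite addKn Ha => /addrI.
Qed.

(** lens n e l: the point of K_n with heights e is given the subdivision l of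
    [0, 1].  The points of the faces are the case t = 0 of lens_cone. *)
Inductive lens : nat -> (nat -> R) -> (nat -> R) -> Prop :=
| lens_corolla n e l : (2 <= n)%N ->
    (forall i, (i < n)%N -> e i = corolla i) ->
    (forall i, (i < n)%N -> l i = n%:R^-1) -> lens n e l
| lens_cone r s n a e1 e2 l1 l2 t e l :
    (2 <= r)%N -> (2 <= s)%N -> (r + s = n.+1)%N -> (a < r)%N ->
    lens r e1 l1 -> lens s e2 l2 -> 0 <= t <= 1 ->
    (forall i, (i < n)%N ->
       e i = (1 - t) * insert +%R a s e1 e2 i + t * corolla i) ->
    (forall i, (i < n)%N ->
       l i = (1 - smooth_step t) * insert *%R a s l1 l2 i
             + smooth_step t * n%:R^-1) ->
    lens n e l.

Lemma convex_heights n e f t : 0 <= t <= 1 -> heights n e -> heights n f ->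
  heights n (fun i => (1 - t) * e i + t * f i).
Proof.
move=> /andP[t0 t1] [e0 e1 eg es] [f0 f1 fg fs]; split.
- by rewrite e0 f0; lra.
- by rewrite e1 f1; lra.
- by move=> i ni; have := eg _ ni; have := fg _ ni; nra.
- by move=> i ni; have := es _ ni; have := fs _ ni; nra.
Qed.

Lemma lens_heights n e l : lens n e l -> heights n e.
Proof.
elim=> {n e l} [n e l n2 eb _|
  r s n a e1 e2 l1 l2 t e l r2 s2 rsn ar _ H1 _ H2 t01 ee _].
  by apply: eq_heights (corolla_heights n) => // i ni; rewrite eb.
apply: (@eq_heights n (fun i => (1 - t) * insert +%R a s e1 e2 i + t * corolla i)).
- lia.
- by move=> i ni; rewrite ee.
- by apply: convex_heights => //; [exact: heights_insert H1 H2|exact: corolla_heights].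
Qed.

Lemma eq_lens n e e' l l' : (forall i, (i < n)%N -> e i = e' i) ->
  (forall i, (i < n)%N -> l i = l' i) -> lens n e l -> lens n e' l'.
Proof.
move=> ee ll H; case: H ee ll => {n e l}.
  move=> n e l n2 eb lb ee ll; apply: lens_corolla => // i ni.
    by rewrite -ee// eb.
  by rewrite -ll// lb.
move=> r s n a e1 e2 l1 l2 t e l r2 s2 rsn ar H1 H2 t01 eb lb ee ll.
apply: (lens_cone r2 s2 rsn ar H1 H2 t01) => i ni.
  by rewrite -ee// eb.
by rewrite -ll// lb.
Qed.

Lemma lens_face r s n a e1 e2 l1 l2 :
    (2 <= r)%N -> (2 <= s)%N -> (r + s = n.+1)%N -> (a < r)%N ->
    lens r e1 l1 -> lens s e2 l2 ->
    lens n (insert +%R a s e1 e2) (insert *%R a s l1 l2).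
Proof.
move=> r2 s2 rsn ar H1 H2; apply: (lens_cone (t := 0) r2 s2 rsn ar H1 H2).
- by rewrite lexx ler01.
- by move=> i _; rewrite subr0 mul1r mul0r addr0.
- by move=> i _; rewrite smooth_step0// subr0 mul1r mul0r addr0.
Qed.

(** The point f satisfies one of the inequalities of K_n with equality.  If
    f_(i+1) = 1, the leaves 0, ..., i form a block.  If f_(i+1) = f_i + 1, a block
    starts at i and ends at the first place where f comes back to f_i + 1 or
    below. *)
Lemma face_exists n f i : heights n f -> (0 < i)%N -> (i.+1 < n)%N ->
  f i.+1 = f i + 1 \/ f i.+1 = 1 ->
  exists a s, [/\ (2 <= s < n)%N, (a + s <= n)%N & block n a s f].
Proof.
move=> [f0 f1 fg fs] i0 ni [fi|fi]; last first.
  exists 0%N, i.+1; split; [lia|lia|split; rewrite ?f0 ?f1 ?add0r ?add0n ?fi//].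
  by move=> j ji; apply: fg; lia.
pose P b := (i.+2 <= b)%N && ((b == n) || (f b <= f i + 1)).
have exP : exists b, P b by exists n; rewrite /P eqxx ni.
case: (ex_minnP exP) => b /andP[ib Pb] bmin.
have bn : (b <= n)%N by apply: bmin; rewrite /P eqxx ni.
have minb j : (i < j < b)%N -> f i + 1 <= f j.
  move=> jb; have [->|ji] := eqVneq j i.+1; first by rewrite fi.
  rewrite leNgt; apply/negP => /ltW fj.
  by have := bmin j; rewrite /P fj orbT andbT => /(_ ltac:(lia)); lia.
exists i, (b - i)%N; split; [lia|lia|split=> //].
  by move=> j ji; apply: minb; lia.
rewrite subnKC; last by lia.
by case/orP: Pb => // /eqP ->; rewrite ltnn.
Qed.

Lemma exists_min (F : nat -> R) m : exists2 i, (0 < i <= m.+1)%N &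
  forall j, (0 < j <= m.+1)%N -> F i <= F j.
Proof.
elim: m => [|m [i im imin]].
  by exists 1%N => // j jm; rewrite (_ : j = 1%N)//; lia.
have [le|lt] := leP (F i) (F m.+2).
  exists i; first by lia.
  by move=> j jm; have [->//|jm'] := eqVneq j m.+2; apply: imin; lia.
exists m.+2; first by lia.
move=> j jm; have [->//|jm'] := eqVneq j m.+2.
by apply: le_trans (ltW lt) _; apply: imin; lia.
Qed.

Lemma corollaS i : (0 < i)%N -> corolla i = 1 + (i%:R - 1) / 2.
Proof. by case: i => // i _; rewrite /corolla/= -[i.+2%:R]natr1; lra. Qed.

(** The coordinate t is the smallest value at e of the affine functions that
    define K_n, each normalized to take the value 1 at b_n: these are A and B in
    the proof.  The ray from b_n through e then leaves K_n where the minimum is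
    reached. *)
Lemma cone_exists n e : (2 <= n)%N -> heights n e ->
  (forall i, (i < n)%N -> e i = corolla i) \/
  exists f t i, [/\ heights n f, 0 <= t <= 1,
    (forall i, e i = (1 - t) * f i + t * corolla i),
    (0 < i)%N /\ (i.+1 < n)%N & f i.+1 = f i + 1 \/ f i.+1 = 1].
Proof.
move=> n2 [e0 e1 eg es].
have [n2'|n3] := leqP n 2.
  left; case=> [|[|i]] ni; rewrite /corolla/=; [by []|by rewrite e1 divff|lia].
(* The facets t_(i+1) >= 0 and e_(i+1) >= 1, normalized to be 1 at b_n. *)
pose A i := 2 * (e i + 1 - e i.+1).
pose B i := (e i.+1 - 1) * 2 / i%:R.
have [i im imin] := exists_min (fun i => Num.min (A i) (B i)) (n - 3).
pose t := Num.min (A i) (B i).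
have tA j : (0 < j)%N -> (j.+1 < n)%N -> t <= A j.
  by move=> j0 jn; have := imin j ltac:(lia); rewrite le_min => /andP[].
have tB j : (0 < j)%N -> (j.+1 < n)%N -> t * j%:R / 2 <= e j.+1 - 1.
  move=> j0 jn; have := imin j ltac:(lia); rewrite le_min => /andP[_].
  by rewrite -/t /B ler_pdivlMr ?ltr0n//; lra.
have t0 : 0 <= t.
  rewrite /t le_min /A /B; apply/andP; split.
    by have := es i ltac:(lia); lra.
  by have := eg i.+1 ltac:(lia) => ?; rewrite divr_ge0//; lra.
(* If all these functions are at least 1, the heights are squeezed to b_n. *)
have [t1|t1] := leP 1 t.
  left; elim=> [|j IH] jn; first by rewrite e0 /corolla.
  have [->|j0] := eqVneq j 0%N; first by rewrite e1 /corolla/= divff.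
  have {}IH := IH ltac:(lia).
  have j0' : (0 < j)%N by lia.
  have := tA j j0' jn; have := tB j j0' jn.
  have : j%:R <= t * j%:R by rewrite ler_peMl.
  by rewrite /A IH !corollaS// -[j.+1%:R]natr1; lra.
have t1' : 1 - t != 0 by rewrite gt_eqF// subr_gt0.
have t1'' : 0 < 1 - t by lra.
have ci : corolla i.+1 = corolla i + 2^-1.
  by rewrite !corollaS//; [rewrite -[i.+1%:R]natr1; lra|lia].
right; exists (fun i => (e i - t * corolla i) / (1 - t)), t, i; split.
- split.
  + by rewrite e0 /corolla/= mulr0 subrr mul0r.
  + by rewrite e1 /corolla/= divff// mulr1 divff.
  + case=> [|[|j]] jn; first by lia.
      by rewrite e1 /corolla/= divff// mulr1 divff.
    rewrite ler_pdivlMr// corollaS// -[j.+2%:R]natr1.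
    by have := tB j.+1 ltac:(lia) ltac:(lia); lra.
  + case=> [|j] jn.
      by rewrite e0 e1 /corolla/= divff// mulr0 mulr1 subrr mul0r divff// add0r.
    rewrite ler_pdivrMr// mulrDl mul1r divfK//.
    have := tA j.+1 ltac:(lia) ltac:(lia); rewrite /A !corollaS//.
    by rewrite -[j.+2%:R]natr1; lra.
- by rewrite t0 ltW.
- by move=> j; field.
- by split; lia.
- cbv beta; have [AB|BA] := leP (A i) (B i); [left|right].
    rewrite ci; have tE : t = 2 * (e i + 1 - e i.+1) by rewrite /t min_l.
    apply: (mulIf t1'); rewrite divfK// [RHS]mulrDl divfK//; lra.
  have tE : t = (e i.+1 - 1) * 2 / i%:R by rewrite /t min_r// ltW.
  have i0 : i%:R != 0 :> R by rewrite pnatr_eq0; lia.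
  have : t * i%:R = (e i.+1 - 1) * 2 by rewrite tE divfK.
  move=> ti; apply: (mulIf t1'); rewrite divfK// corollaS// -[i.+1%:R]natr1; lra.
Qed.

Lemma lens_total n e : (2 <= n)%N -> heights n e -> exists l, lens n e l.
Proof.
elim/ltn_ind: n e => n IH e n2 He.
have [ec|[f [t [i [Hf t01 ef [i0 ni] fi]]]]] := cone_exists n2 He.
  by exists (fun=> n%:R^-1); exact: lens_corolla.
have [a [s [sn asn B]]] := face_exists Hf i0 ni fi.
have s2 : (2 <= s)%N by lia.
have r2 : (2 <= n - s + 1)%N by lia.
have rsn : (n - s + 1 + s = n.+1)%N by lia.
have ar : (a < n - s + 1)%N by lia.
have [|l1 H1] := IH (n - s + 1)%N _ (outer a s f) r2 (outer_heights s2 r2 rsn ar Hf B).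
  lia.
have [|l2 H2] := IH s _ (inner a f) s2 (inner_heights s2 asn Hf B).
  lia.
exists (fun i => (1 - smooth_step t) * insert *%R a s l1 l2 i
             + smooth_step t * n%:R^-1).
apply: (lens_cone r2 s2 rsn ar H1 H2 t01) => // j jn.
by rewrite (insert_outer_inner _ _ asn)// ltnW.
Qed.

(** In an overlap a < b < a + s < b + t, the first block puts e_b at or above
    e_a + 1 and e_(a+s) at most at e_a + 1, whereas the second one keeps e_(a+s)
    above e_b. *)
Lemma block_laminar n a s b t e : heights n e -> block n a s e -> block n b t e ->
  (2 <= s)%N -> (2 <= t)%N -> (a + s <= n)%N -> (b + t <= n)%N ->
  ~ [/\ (a < b)%N, (b < a + s)%N & (a + s < b + t)%N].
Proof.
move=> [_ _ _ es] [a1 ag ae] [b1 bg be] s2 t2 asn btn [ab bas asbt].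
have := ae ltac:(lia); have := ag b ltac:(lia).
have [asb|asb] := eqVneq (a + s)%N b.+1; first by rewrite asb b1; lra.
by have := bg (a + s)%N ltac:(lia); lra.
Qed.

Section functionality.
Variable n : nat.
Hypothesis IH : forall m, (m < n)%N -> forall e l l',
  lens m e l -> lens m e l' -> forall i, (i < m)%N -> l i = l' i.
Variables (r s a r' s' a' : nat) (e1 e2 l1 l2 e1' e2' l1' l2' : nat -> R).
Hypotheses (r2 : (2 <= r)%N) (s2 : (2 <= s)%N) (rsn : (r + s = n.+1)%N).
Hypotheses (ar : (a < r)%N) (H1 : lens r e1 l1) (H2 : lens s e2 l2).
Hypotheses (r2' : (2 <= r')%N) (s2' : (2 <= s')%N) (rsn' : (r' + s' = n.+1)%N).
Hypotheses (ar' : (a' < r')%N) (H1' : lens r' e1' l1') (H2' : lens s' e2' l2').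
Hypothesis ee : forall i, (i < n)%N ->
  insert +%R a s e1 e2 i = insert +%R a' s' e1' e2' i.

Let B' : block n a' s' (insert +%R a s e1 e2).
Proof.
have [b1 bg be] := block_insert r2' s2' rsn' ar' (lens_heights H1') (lens_heights H2').
split=> [|i ia|ia]; rewrite !ee;
    [exact: b1|lia|lia|exact: bg|lia|lia|exact: be|lia|lia].
Qed.

Let e20 : e2 0%N = 0. Proof. by have [] := lens_heights H2. Qed.
Let e20' : e2' 0%N = 0. Proof. by have [] := lens_heights H2'. Qed.

(** The second block lies in the first one, so e2 is itself on a face, with
    components g and h.  By sequential associativity and injectivity of the face
    operators, e2' = h and e1' is the composite of e1 and g, and the lengths of
    these points are known by induction. *)
Lemma lens_insert_nested : (a <= a')%N -> (a' + s' <= a + s)%N ->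
  forall i, (i < n)%N -> insert *%R a s l1 l2 i = insert *%R a' s' l1' l2' i.
Proof.
move=> aa ss; have [ses|ses] := eqVneq s s'.
  have ea : a = a' by lia.
  have er : r = r' by lia.
  move: H1' H2' ee; rewrite -ses -ea -er => K1 K2 E.
  have [E1 E2] := insert_add_inj (ltnW s2) rsn ar e20 e20' E.
  apply: eq_insert rsn ar _ _; [lia|apply: IH H1 _; first by lia|
    apply: IH H2 _; first by lia].
    by apply: eq_lens K1 => // i ir; rewrite E1.
  by apply: eq_lens K2 => // i ir; rewrite E2.
pose b := (a' - a)%N; pose t := (s - s' + 1)%N.
have t2 : (2 <= t)%N by rewrite /t; lia.
have ts : (t + s' = s.+1)%N by rewrite /t; lia.
have tE : (t + s' - 1 = s)%N by lia.
have bE : (a + b = a')%N by rewrite /b; lia.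
have bt : (b < t)%N by rewrite /b /t; lia.
have bs : (b + s' <= s)%N by rewrite /b; lia.
have Fe j : (j < s)%N -> insert +%R a s e1 e2 (a + j)%N = e1 a + e2 j.
  move=> js; rewrite /insert; have -> : (a + j < a)%N = false by lia.
  by rewrite ltn_add2l js addKn.
have Bin : block s b s' e2.
  have [b1 bg be] := B'; split.
  - move: b1; rewrite -bE -addnS !Fe; [lra|lia|lia].
  - move=> i ib; have := bg (a + i)%N ltac:(lia); rewrite -bE !Fe; [lra|lia|lia].
  - move=> ib; have := be ltac:(lia); rewrite -bE -addnA !Fe; [lra|lia|lia].
have Hg := outer_heights s2' t2 ts bt (lens_heights H2) Bin.
have Hh := inner_heights s2' bs (lens_heights H2) Bin.
have [lg Lg] := lens_total t2 Hg; have [lh Lh] := lens_total s2' Hh.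
have e2E : forall i, insert +%R b s' (outer b s' e2) (inner b e2) i = e2 i.
  by apply: insert_outer_inner bs; lia.
have rt : (r + t = r'.+1)%N by lia.
have E i : (i < n)%N ->
    insert +%R a' s' (insert +%R a t e1 (outer b s' e2)) (inner b e2) i =
    insert +%R a' s' e1' e2' i.
  move=> ni; rewrite -ee// -bE -insert_nested; [|exact: addrA|lia|lia|exact: bt].
  by rewrite tE; apply: eq_insert rsn ar _ _ _ ni => //; lia.
have [E1 E2] := insert_add_inj (ltnW s2') rsn' ar' (inner0 _ _) e20' E.
have L2 := eq_lens (fun i _ => e2E i) (fun _ _ => erefl) (lens_face t2 s2' ts bt Lg Lh).
have L1' := eq_lens E1 (fun _ _ => erefl) (lens_face r2 t2 rt ar H1 Lg).
have lE2 := IH (ltac:(lia) : (s < n)%N) H2 L2.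
have lE1' := IH (ltac:(lia) : (r' < n)%N) L1' H1'.
have lE2' := IH (ltac:(lia) : (s' < n)%N) (eq_lens E2 (fun _ _ => erefl) Lh) H2'.
move=> i ni; transitivity (insert *%R a s l1 (insert *%R b s' lg lh) i).
  by apply: eq_insert rsn ar _ _ _ ni => //; lia.
rewrite -{1}tE insert_nested; [|exact: mulrA|lia|lia|exact: bt].
by rewrite bE; apply: eq_insert rsn' ar' _ _ _ ni => //; lia.
Qed.

(** As for nested blocks, with a face through e1 and parallel associativity. *)
Lemma lens_insert_disjoint : (a + s <= a')%N ->
  forall i, (i < n)%N -> insert *%R a s l1 l2 i = insert *%R a' s' l1' l2' i.
Proof.
move=> aa; pose b := (a' - s + 1)%N; pose t := (r - s' + 1)%N.
have t2 : (2 <= t)%N by rewrite /t; lia.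
have ts : (t + s' = r.+1)%N by rewrite /t; lia.
have bE : (b + s - 1 = a')%N by rewrite /b; lia.
have bt : (b < t)%N by rewrite /b /t; lia.
have ab : (a < b)%N by rewrite /b; lia.
have at_ : (a < t)%N by lia.
have bs : (b + s' <= r)%N by rewrite /b; lia.
have Fe j : (a < j)%N -> insert +%R a s e1 e2 (j + s - 1)%N = e1 j.
  move=> aj; rewrite /insert; have -> : (j + s - 1 < a)%N = false by lia.
  have -> : (j + s - 1 < a + s)%N = false by lia.
  by congr e1; lia.
have Bin : block r b s' e1.
  have [b1 bg be] := B'; split.
  - move: b1; rewrite -bE Fe//.
    by rewrite (_ : (b + s - 1).+1 = b.+1 + s - 1)%N ?Fe//; lia.
  - move=> i ib; have := bg (i + s - 1)%N ltac:(lia); rewrite -bE !Fe//; lia.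
  - move=> ib; have := be ltac:(lia); rewrite -bE Fe//.
    by rewrite (_ : b + s - 1 + s' = b + s' + s - 1)%N ?Fe//; lia.
have Hg := outer_heights s2' t2 ts bt (lens_heights H1) Bin.
have Hh := inner_heights s2' bs (lens_heights H1) Bin.
have [lg Lg] := lens_total t2 Hg; have [lh Lh] := lens_total s2' Hh.
have e1E : forall i, insert +%R b s' (outer b s' e1) (inner b e1) i = e1 i.
  by apply: insert_outer_inner bs; lia.
have rt : (t + s = r'.+1)%N by lia.
have E i : (i < n)%N ->
    insert +%R a' s' (insert +%R a s (outer b s' e1) e2) (inner b e1) i =
    insert +%R a' s' e1' e2' i.
  move=> ni; rewrite -ee// -bE -insert_disjoint; [|lia|lia|exact: ab].
  by apply: eq_insert rsn ar _ _ _ ni => //; lia.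
have [E1 E2] := insert_add_inj (ltnW s2') rsn' ar' (inner0 _ _) e20' E.
have L1 := eq_lens (fun i _ => e1E i) (fun _ _ => erefl) (lens_face t2 s2' ts bt Lg Lh).
have L1' := eq_lens E1 (fun _ _ => erefl) (lens_face t2 s2 rt at_ Lg H2).
have lE1 := IH (ltac:(lia) : (r < n)%N) H1 L1.
have lE1' := IH (ltac:(lia) : (r' < n)%N) L1' H1'.
have lE2' := IH (ltac:(lia) : (s' < n)%N) (eq_lens E2 (fun _ _ => erefl) Lh) H2'.
move=> i ni; transitivity (insert *%R a s (insert *%R b s' lg lh) l2 i).
  by apply: eq_insert rsn ar _ _ _ ni => //; lia.
rewrite insert_disjoint; [|lia|lia|exact: ab].
by rewrite bE; apply: eq_insert rsn' ar' _ _ _ ni => //; lia.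
Qed.

End functionality.

Lemma lens_insert_functional n r s a r' s' a' e1 e2 l1 l2 e1' e2' l1' l2' :
  (forall m, (m < n)%N -> forall e l l',
     lens m e l -> lens m e l' -> forall i, (i < m)%N -> l i = l' i) ->
  (2 <= r)%N -> (2 <= s)%N -> (r + s = n.+1)%N -> (a < r)%N ->
  lens r e1 l1 -> lens s e2 l2 ->
  (2 <= r')%N -> (2 <= s')%N -> (r' + s' = n.+1)%N -> (a' < r')%N ->
  lens r' e1' l1' -> lens s' e2' l2' ->
  (forall i, (i < n)%N ->
     insert +%R a s e1 e2 i = insert +%R a' s' e1' e2' i) ->
  forall i, (i < n)%N -> insert *%R a s l1 l2 i = insert *%R a' s' l1' l2' i.
Proof.
move=> IH; wlog aa : r s a r' s' a' e1 e2 l1 l2 e1' e2' l1' l2' / (a <= a')%N.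
  move=> W; have [aa|aa] := leqP a a'; first exact: W.
  move=> h1 h2 h3 h4 h5 h6 h7 h8 h9 h10 h11 h12 ee i ni; apply/esym.
  by apply: (W _ _ _ _ _ _ _ _ _ _ _ _ _ _ (ltnW aa) h7 h8 h9 h10 h11 h12
    h1 h2 h3 h4 h5 h6 _ i ni) => j nj; rewrite ee.
move=> r2 s2 rsn ar H1 H2 r2' s2' rsn' ar' H1' H2' ee i ni.
have [ss|ss] := leqP (a' + s') (a + s).
  exact: (lens_insert_nested IH r2 s2 rsn ar H1 H2 r2' s2' rsn' ar' H1' H2').
have [as'|as'] := leqP (a + s) a'.
  exact: (lens_insert_disjoint IH r2 s2 rsn ar H1 H2 r2' s2' rsn' ar' H1' H2').
have [aE|aE] := eqVneq a a'.
  apply/esym.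
  apply: (lens_insert_nested IH r2' s2' rsn' ar' H1' H2' r2 s2 rsn ar H1 H2) => //.
  - by move=> j nj; rewrite ee.
  - by lia.
  - by lia.
exfalso.
have He := heights_insert r2 s2 rsn ar (lens_heights H1) (lens_heights H2).
have Bl := block_insert r2 s2 rsn ar (lens_heights H1) (lens_heights H2).
have [b1 bg be] := block_insert r2' s2' rsn' ar' (lens_heights H1') (lens_heights H2').
have Bl' : block n a' s' (insert +%R a s e1 e2).
  split=> [|j ja|ja]; rewrite !ee;
    [exact: b1|lia|lia|exact: bg|lia|lia|exact: be|lia|lia].
by apply: (block_laminar He Bl Bl') => //; [lia|lia|split; lia].
Qed.

(** One of the affine functions that define K_n vanishes on the face, is
    nonnegative at f and takes the value 1/2 or more at b_n; comparing its values
    on both sides bounds u. *)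
Lemma cone_param_uniq n r s a e1 e2 f t u : (2 <= r)%N -> (2 <= s)%N ->
  (r + s = n.+1)%N -> (a < r)%N -> heights r e1 -> heights s e2 ->
  heights n f -> t < 1 -> 0 <= u -> u <= 1 ->
  (forall i, (i < n)%N -> (1 - t) * insert +%R a s e1 e2 i + t * corolla i =
     (1 - u) * f i + u * corolla i) -> u <= t.
Proof.
move=> r2 s2 rsn ar H1 H2 [f0 f1 fg fs] t1 u0 u1 H; rewrite leNgt; apply/negP => tu.
have [b1 bg be] := block_insert r2 s2 rsn ar H1 H2.
have [x0 x1 xg xs] := heights_insert r2 s2 rsn ar H1 H2.
move: b1 bg be x0 x1 xg xs H; set x := insert _ _ _ _ _ => b1 bg be x0 x1 xg xs H.
(* For a = 0 the facet is e_s = 1, and otherwise e_(a+1) = e_a + 1. *)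
have [a0|a0] := eqVneq a 0%N.
  have := be ltac:(lia); have := xg s ltac:(lia); have := fg s ltac:(lia).
  have := H s ltac:(lia); rewrite corollaS; last by lia.
  have : 1 <= s%:R - 1 :> R.
    by rewrite lerBrDr -[1 + 1]/(2%:R) ler_nat; lia.
  rewrite a0 x0 add0n add0r; set c := s%:R - 1 => c1 Hs F1 X1 X1'.
  have XE : x s = 1 by lra.
  rewrite XE in Hs; have : 0 < (u - t) * c by rewrite mulr_gt0//; lra.
  have : 0 <= (1 - u) * (f s - 1) by rewrite mulr_ge0//; lra.
  by lra.
have := H a ltac:(lia); have := H a.+1 ltac:(lia); have := fs a ltac:(lia).
rewrite !corollaS//; last by lia.
rewrite -[a.+1%:R]natr1 b1 => F Ha1 Ha.
have : 0 <= (1 - u) * (f a + 1 - f a.+1) by rewrite mulr_ge0//; lra.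
by lra.
Qed.

Lemma cone_not_corolla n r s a e1 e2 t : (2 <= r)%N -> (2 <= s)%N ->
  (r + s = n.+1)%N -> (a < r)%N -> heights r e1 -> heights s e2 -> t <= 1 ->
  (forall i, (i < n)%N ->
    (1 - t) * insert +%R a s e1 e2 i + t * corolla i = corolla i) -> t = 1.
Proof.
move=> r2 s2 rsn ar H1 H2 t1 H; apply/eqP; rewrite eq_le t1 /= leNgt.
apply/negP => t1'.
have := cone_param_uniq r2 s2 rsn ar H1 H2 (corolla_heights n) t1' ler01 (lexx _).
suff E : (forall i, (i < n)%N -> (1 - t) * insert +%R a s e1 e2 i + t * corolla i =
     (1 - 1) * corolla i + 1 * corolla i) by move=> /(_ E); lra.
by move=> i ni; rewrite H// subrr mul0r mul1r add0r.
Qed.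

Lemma lens_functional n e l l' : lens n e l -> lens n e l' ->
  forall i, (i < n)%N -> l i = l' i.
Proof.
elim/ltn_ind: n e l l' => n IH e l l' H; move: IH.
case: n e l / H => [n e l n2 ec lc|r s n a e1 e2 l1 l2 t e l r2 s2 rsn ar H1 H2].
  move=> _ H'; case: n e l' / H' n2 ec lc => [n e l' _ _ lc'|
      r s n a e1 e2 l1 l2 t e l' r2 s2 rsn ar H1 H2 /andP[_ t1] ef lf] n2 ec lc i ni.
    by rewrite lc ?lc'.
  rewrite lf// (_ : t = 1) ?smooth_step1 ?subrr ?mul0r ?add0r ?mul1r ?lc//.
  apply: (cone_not_corolla r2 s2 rsn ar (lens_heights H1) (lens_heights H2) t1).
  by move=> j jn; rewrite -ef ?ec.
move=> t01 ef lf IH H'; move: IH rsn ef lf; have /andP[t0 t1] := t01.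
case: n e l' / H' => [n e l' n2 ec lc|
    r' s' n a' e1' e2' l1' l2' u e l' r2' s2' rsn' ar' H1' H2' u01 ef' lf']
  IH rsn ef lf i ni.
  rewrite lf// (_ : t = 1) ?smooth_step1 ?subrr ?mul0r ?add0r ?mul1r ?lc//.
  apply: (cone_not_corolla r2 s2 rsn ar (lens_heights H1) (lens_heights H2) t1).
  by move=> j jn; rewrite -ef ?ec.
have /andP[u0 u1] := u01.
have Hf := heights_insert r2 s2 rsn ar (lens_heights H1) (lens_heights H2).
have Hf' := heights_insert r2' s2' rsn' ar' (lens_heights H1') (lens_heights H2').
have tu : t < 1 -> u <= t.
  move=> lt; apply: (cone_param_uniq r2 s2 rsn ar
    (lens_heights H1) (lens_heights H2) Hf' lt u0 u1) => j nj; by rewrite -ef// ef'.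
have ut : u < 1 -> t <= u.
  move=> lt; apply: (cone_param_uniq r2' s2' rsn' ar'
    (lens_heights H1') (lens_heights H2') Hf lt t0 t1) => j nj; by rewrite -ef// ef'.
have tuE : t = u.
  have [t1'|t1'] := ltP t 1; last by have [/ut|] := ltP u 1; lra.
  have := tu t1' => ut'; apply/eqP; rewrite eq_le ut' andbT ut//; lra.
rewrite lf// lf'// -tuE; have [t1'|t1'] := ltP t 1; last first.
  by rewrite smooth_step1// subrr !mul0r.
congr (_ * _ + _).
apply: (lens_insert_functional IH r2 s2 rsn ar H1 H2 r2' s2' rsn' ar' H1' H2') => // j nj.
have := ef j nj; rewrite ef'// -tuE => /addIr /mulfI -> //.
by rewrite gt_eqF//; lra.
Qed.

(** The breakpoints of the subdivision. *)
Definition psum l i : R := \sum_(0 <= j < i) l j.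

Lemma psum0 l : psum l 0 = 0. Proof. by rewrite /psum big_geq. Qed.

Lemma psumS l i : psum l i.+1 = psum l i + l i.
Proof. by rewrite /psum big_nat_recr. Qed.

Lemma eq_psum l l' n : (forall i, (i < n)%N -> l i = l' i) ->
  forall i, (i <= n)%N -> psum l i = psum l' i.
Proof.
move=> ll; elim=> [|i IH] ni; first by rewrite !psum0.
by rewrite !psumS IH ?ll//; lia.
Qed.

Lemma psum_insert a s l1 l2 : psum l2 s = 1 -> forall i,
  psum (insert *%R a s l1 l2) i =
    if (i < a)%N then psum l1 i
    else if (i < a + s)%N then psum l1 a + l1 a * psum l2 (i - a)
    else psum l1 (i - s + 1)%N.
Proof.
move=> l2s; have s0 : (0 < s)%N.
  by case: s l2s => //; rewrite psum0 => /eqP; rewrite eq_sym oner_eq0.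
elim=> [|i IH].
  rewrite psum0; case: ifP => a0; first by rewrite psum0.
  have -> : a = 0%N by lia.
  by rewrite add0n s0 sub0n !psum0 mulr0 addr0.
rewrite psumS {}IH /insert.
have [ia|ia] := ltnP i.+1 a; first by rewrite ltnW// psumS.
have [ia'|ia'] := ltnP i a.
  have -> : a = i.+1 by lia.
  have -> : (i.+1 < i.+1 + s)%N = true by lia.
  by rewrite psumS subnn psum0 mulr0 addr0.
have [ias|ias] := ltnP i.+1 (a + s).
  have -> : (i < a + s)%N = true by lia.
  by rewrite subSn// psumS mulrDr addrA.
have [ias'|ias'] := ltnP i (a + s).
  rewrite -addrA -mulrDr -psumS -subSn//.
  have -> : (i.+1 - a = s)%N by lia.
  have -> : (i.+1 - s + 1 = a.+1)%N by lia.
  by rewrite l2s mulr1 psumS.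
have -> : (i.+1 - s + 1 = (i - s + 1).+1)%N by lia.
by rewrite psumS.
Qed.

Lemma lens_gt0 n e l : lens n e l -> forall i, (i < n)%N -> 0 < l i.
Proof.
elim=> {n e l} [n e l n2 _ lc|
  r s n a e1 e2 l1 l2 t e l r2 s2 rsn ar _ l10 _ l20 _ _ lE] i ni.
  by rewrite lc// invr_gt0 ltr0n; lia.
have p0 : 0 < insert *%R a s l1 l2 i.
  rewrite /insert; case: ifP => ia; first by apply: l10; lia.
  case: ifP => ias; last by apply: l10; lia.
  by apply: mulr_gt0; [apply: l10|apply: l20; lia].
have n0 : 0 < n%:R^-1 :> R by rewrite invr_gt0 ltr0n; lia.
rewrite lE//; have /andP[s0 s1] := smooth_step_itv t.
have [->|sn0] := eqVneq (smooth_step t) 0; first by rewrite subr0 mul1r mul0r addr0.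
apply: ltr_wpDl; first by rewrite mulr_ge0 ?subr_ge0// ltW.
by rewrite mulr_gt0// lt_def sn0 s0.
Qed.

Lemma lens_psum1 n e l : lens n e l -> psum l n = 1.
Proof.
elim=> {n e l} [n e l n2 _ lc|
  r s n a e1 e2 l1 l2 t e l r2 s2 rsn ar _ l10 _ l20 _ _ lE].
  rewrite (eq_psum lc (leqnn n)) /psum big_const_nat subn0 iter_addr_0 -[_ *+ n]mulr_natr.
  by rewrite mulVf// pnatr_eq0; lia.
have nn : n%:R != 0 :> R by rewrite pnatr_eq0; lia.
rewrite (eq_psum lE (leqnn n)) /psum big_split/= -mulr_sumr.
rewrite -/(psum (insert *%R a s l1 l2) n) psum_insert// ifF; last by lia.
rewrite ifF; last by lia.
have -> : (n - s + 1 = r)%N by lia.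
rewrite l10 mulr1 big_const_nat subn0 iter_addr_0 -[_ *+ n]mulr_natr mulfVK//.
by rewrite subrK.
Qed.

End heights.

(** * Heights of points of the associahedra *)

Section associahedron_heights.
Variable R : realType.
Implicit Types (n r s k : nat).

Definition height n (t : 'rV[R]_n) (i : nat) : R :=
  i%:R - \sum_(1 <= j < i.+1) coord t j.

Lemma height0 n (t : 'rV[R]_n) : height t 0 = 0.
Proof. by rewrite /height big_geq// subr0. Qed.

Lemma heightS n (t : 'rV[R]_n) i : height t i.+1 = height t i + 1 - coord t i.+1.
Proof. by rewrite /height big_nat_recr//= -natr1; lra. Qed.

Lemma height_heights n (t : 'rV[R]_n) : (2 <= n)%N -> associahedron t ->
  heights n (height t).
Proof.
move=> n2 /(associahedronP _ n2)[t1 t0 tk tn]; split.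
- exact: height0.
- by rewrite heightS height0 t1; lra.
- by move=> i ni; have := tk i ltac:(lia); rewrite /height; lra.
- by move=> i ni; have := t0 i.+1 ltac:(lia); rewrite heightS; lra.
Qed.

Lemma height_last n (t : 'rV[R]_n) : (2 <= n)%N -> associahedron t ->
  height t n = 1.
Proof. by move=> n2 /(associahedronP _ n2)[_ _ _]; rewrite /height => ->; lra. Qed.

Lemma height_base n i : (i < n)%N -> height (base_point R n) i = corolla R i.
Proof.
elim: i => [|i IH] ni; first by rewrite height0.
pose b k : R := if k == 1%N then 0 else if k == n then n%:R / 2 else 1 / 2.
rewrite heightS IH; last by lia.
rewrite (_ : coord _ _ = b i.+1); last by apply: coordE; lia.
rewrite /b eqSS; have [->|i0] := eqVneq i 0%N; first by rewrite /corolla/=; lra.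
rewrite ifF; last by lia.
by rewrite !corollaS -?[i.+1%:R]natr1//; [lra|lia].
Qed.

Lemma height_convex n (t u : 'rV[R]_n) (a : R) i :
  height ((1 - a) *: t + a *: u) i = (1 - a) * height t i + a * height u i.
Proof.
rewrite /height !mulrBr !mulr_sumr addrACA -opprD -big_split -mulrDl subrK mul1r.
by congr (_ - _); apply: eq_bigr => j _; rewrite coordD !coordZ.
Qed.

(** Inside the block the heights of u are shifted by the height of t at the
    leaf that is replaced; behind it the heights are those of t again since the
    coordinates of u have sum s - 1. *)
Lemma height_face r s n k (t : 'rV[R]_r) (u : 'rV[R]_s) i : face_index r s n k ->
  associahedron u -> (i < n)%N ->
  height (face n k t u) i = insert +%R k.-1 s (height t) (height u) i.
Proof.
move=> /and4P[r2 s2 /eqP rsn /andP[k1 kr]] Hu.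
pose v j : R := if (j < k)%N then coord t j
     else if (j < k + s - 1)%N then coord u (j - k + 1)
     else if j == (k + s - 1)%N then coord u s + coord t k
     else coord t (j - s + 1).
have cv j : (1 <= j <= n)%N -> coord (face n k t u) j = v j by exact: coordE.
elim: i => [|i IH] ni.
  rewrite height0 /insert; case: ifP => k0; first by rewrite height0.
  rewrite ifT ?sub0n; last by lia.
  have -> : k.-1 = 0%N by lia.
  by rewrite !height0 addr0.
rewrite heightS {}IH ?cv; [|lia|lia].
rewrite /insert /v.
have [ik|ik] := ltnP i.+1 k.-1.
  rewrite ifT; last by lia.
  by rewrite ifT ?heightS//; lia.
have [ik'|ik'] := ltnP i k.-1.
  rewrite ifT; last by lia.
  rewrite ifT; last by lia.
  have <- : i.+1 = k.-1 by lia.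
  by rewrite subnn height0 addr0 heightS.
have -> : (i.+1 < k)%N = false by lia.
have [iks|iks] := ltnP i.+1 (k + s - 1).
  rewrite ifT; last by lia.
  rewrite ifT; last by lia.
  have -> : (i.+1 - k + 1 = (i - k.-1).+1)%N by lia.
  by rewrite subSn// heightS; lra.
have -> : (i.+1 < k.-1 + s)%N = false by lia.
case: eqP => [iE|iE].
  rewrite ifT; last by lia.
  have -> : (i.+1 - s + 1 = k.-1.+1)%N by lia.
  rewrite heightS prednK//.
  have := height_last s2 Hu; have -> : (i - k.-1 = s.-1)%N by lia.
  have hS : height u s.-1.+1 = height u s.-1 + 1 - coord u s.-1.+1 by rewrite heightS.
  by move: hS; rewrite prednK; [lra|lia].
rewrite ifF; last by lia.
have -> : (i.+1 - s + 1 = (i - s + 1).+1)%N by lia.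
by rewrite heightS.
Qed.

Lemma smooth_on_lsubmx m p (f : 'rV[R]_m -> R) :
  smooth_on setT f -> smooth_on setT (fun z : 'rV[R]_(m + p) => f (lsubmx z)).
Proof.
move=> sf k; apply: (@Ck_comp R _ _ k setT setT f (@lsubmx R 1 m p)) => //.
  exact: openT.
move=> j; apply: Ck_ext (@smooth_on_coord R (m + p) setT (lshift p j) k) => //.
  exact: openT.
by move=> x _; rewrite mxE.
Qed.

Lemma smooth_on_rsubmx m p (f : 'rV[R]_p -> R) :
  smooth_on setT f -> smooth_on setT (fun z : 'rV[R]_(m + p) => f (rsubmx z)).
Proof.
move=> sf k; apply: (@Ck_comp R _ _ k setT setT f (@rsubmx R 1 m p)) => //.
  exact: openT.
move=> j; apply: Ck_ext (@smooth_on_coord R (m + p) setT (rshift m j) k) => //.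
  exact: openT.
by move=> x _; rewrite mxE.
Qed.

Lemma smooth_on_insert_mul m p a s (f : nat -> 'rV[R]_m -> R)
    (g : nat -> 'rV[R]_p -> R) i :
  (forall j, smooth_on setT (f j)) -> (forall j, smooth_on setT (g j)) ->
  smooth_on setT (fun z : 'rV[R]_(m + p) =>
    insert *%R a s (fun j => f j (lsubmx z)) (fun j => g j (rsubmx z)) i).
Proof.
move=> sf sg; rewrite /insert; case: (i < a)%N.
  exact: (@smooth_on_lsubmx m p (f i) (sf i)).
case: (i < a + s)%N; last exact: (@smooth_on_lsubmx m p (f _) (sf _)).
apply: smooth_onM; first exact: openT.
  exact: (@smooth_on_lsubmx m p (f a) (sf a)).
exact: (@smooth_on_rsubmx m p (g _) (sg _)).
Qed.

(** The coordinates of R^q are smooth, and each cone coordinate enters through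
    smooth_step only. *)
Lemma cell_lens n (c : cell R n) : cubic_cell c ->
  exists L : nat -> 'rV[R]_(cell_dim c) -> R,
    (forall i, smooth_on setT (L i)) /\
    (forall z, lens n (height (cell_param z)) (fun i => L i z)).
Proof.
elim=> {n c} [n n2|r s n k rho kappa H crho [L1 [sL1 lL1]] ckap [L2 [sL2 lL2]]|
  r s n k rho kappa H crho [L1 [sL1 lL1]] ckap [L2 [sL2 lL2]]].
- exists (fun _ _ => n%:R^-1); split; first by move=> i; exact: smooth_on_cst.
  by move=> z; apply: lens_corolla => // i ni; exact: height_base.
- have := H; rewrite /face_index => /and4P[r2 s2 /eqP rsn kr].
  have kr' : (k.-1 < r)%N by lia.
  exists (fun i z =>
    insert *%R k.-1 s (fun j => L1 j (lsubmx z)) (fun j => L2 j (rsubmx z)) i).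
  split; first by move=> i; exact: smooth_on_insert_mul.
  move=> z.
  have := lens_face r2 s2 rsn kr' (lL1 (lsubmx z)) (lL2 (rsubmx z)).
  apply: eq_lens => // i ni.
  rewrite [RHS]height_face//.
  by apply: (cubic_cell_sub ckap); exact: cell_param_in.
- have := H; rewrite /face_index => /and4P[r2 s2 /eqP rsn kr].
  have kr' : (k.-1 < r)%N by lia.
  pose F i (z : 'rV[R]_(cell_dim rho + cell_dim kappa)) :=
    insert *%R k.-1 s (fun j => L1 j (lsubmx z)) (fun j => L2 j (rsubmx z)) i.
  pose T (z : 'rV[R]_(cell_dim rho + cell_dim kappa + 1)) := smooth_step (rsubmx z 0 0).
  have sT : smooth_on setT T.
    apply: (@smooth_on_rsubmx _ 1 (fun y => smooth_step (y 0 0))).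
    by apply: smooth_on_step; [exact: openT|exact: smooth_on_coord].
  exists (fun i z => (1 - T z) * F i (lsubmx z) + T z * n%:R^-1); split.
    move=> i; apply: smooth_onD; first exact: openT.
      apply: smooth_onM; first exact: openT.
        by apply: smooth_onB; [exact: openT|exact: smooth_on_cst|].
      by apply: smooth_on_lsubmx; exact: smooth_on_insert_mul.
    by apply: smooth_onM; [exact: openT| |exact: smooth_on_cst].
  move=> z; have t01 := pi_set_itv (rsubmx z 0 0).
  apply: (lens_cone r2 s2 rsn kr' (lL1 (lsubmx (lsubmx z)))
    (lL2 (rsubmx (lsubmx z))) t01) => i ni.
    rewrite [LHS]height_convex height_base// height_face//.
    apply: (cubic_cell_sub ckap); exact: cell_param_in.
  by rewrite smooth_step_pi_set.
Qed.

End associahedron_heights.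

(** * Lengths as smooth functions on the cubic complexes *)

Section final.
Variable R : realType.

(** Comparing a final diffeology with this one gives its universal property. *)
Program Definition pullback_diffeology (Z : Type) (Y : diffSpace R) (g : Z -> Y) :
    diffeology R Z :=
  @Diffeology R Z (fun m U P => is_plot U (g \o P)) _ _ _ _ _.
Next Obligation. by move=> Z Y g m U P /plot_open. Qed.
Next Obligation.
by move=> Z Y g m U P Q PQ; apply: plot_ext => u Uu /=; rewrite PQ.
Qed.
Next Obligation. by move=> Z Y g m U x oU; exact: plot_cst. Qed.
Next Obligation. by move=> Z Y g m n U V P f; exact: plot_comp. Qed.
Next Obligation. by move=> Z Y g m U P; exact: plot_local. Qed.

Lemma smooth_wrt_final (I : Type) (A : I -> diffSpace R) (Z : Type)
    (f : forall i, A i -> Z) (Y : diffSpace R) (g : Z -> Y) :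
  (forall i, smooth_wrt (structure (A i)) (structure Y) (g \o f i)) ->
  smooth_wrt (final_diffeology f) (structure Y) g.
Proof. by move=> gf m U P [_ /(_ (pullback_diffeology g))]; apply. Qed.

Lemma lengths_exist n (n2 : (2 <= n)%N) (x : complexSpace R n) :
  exists l, lens n (height (sval x)) l.
Proof. by apply: lens_total (height_heights _ (svalP x)). Qed.

Definition lengths n (n2 : (2 <= n)%N) (x : complexSpace R n) : nat -> R :=
  sval (cid (lengths_exist n2 x)).

Lemma lengthsP n (n2 : (2 <= n)%N) (x : complexSpace R n) :
  lens n (height (sval x)) (lengths n2 x).
Proof. exact: svalP (cid (lengths_exist n2 x)). Qed.

Lemma lengths_smooth n (n2 : (2 <= n)%N) i : (i < n)%N ->
  smooth (fun x : complexSpace R n => lengths n2 x i : realLine R).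
Proof.
move=> ni; apply: smooth_wrt_final => -[c cc]; apply: smooth_wrt_final => _.
move=> m U P [oU sP]; split=> // k.
have [L [sL lL]] := cell_lens cc.
have := @Ck_comp R m _ k setT U (L i) P oU (fun _ _ => Logic.I)
  (fun j => sP j k) (sL i k).
apply: Ck_ext => // u Uu /=.
pose x : cellSpace c := cell_proj (P u : euclidean R (cell_dim c)).
exact: (lens_functional (lL (P u))
  (lengthsP n2 (cell_incl (sigma := exist _ c cc) x)) ni).
Qed.

End final.

(** * Concatenation along a subdivision *)

Section concatenation.
Variables (R : realType) (X : Type).
Implicit Types (n m i : nat) (l : nat -> R) (u : nat -> R -> X).

(** The first m + 1 paths, the last one being extended to all later times. *)
Fixpoint concat l u m (t : R) : X :=
  if m is m'.+1 then
    if t <= psum l m then concat l u m' t else u m ((t - psum l m) / l m)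
  else u 0%N (t / l 0%N).

(** A description of the concatenation without division, by which it is unique.
    The face equations are checked on it. *)
Definition is_concat n l u (C : R -> X) : Prop :=
  (forall t, C (pi_set t) = C t) /\
  forall i, (i < n)%N -> forall s, 0 <= s <= 1 -> C (psum l i + l i * s) = u i s.

Variables (n : nat) (l : nat -> R).
Hypotheses (l0 : forall i, (i < n)%N -> 0 < l i) (l1 : psum l n = 1).

Lemma psum_le i j : (i <= j <= n)%N -> psum l i <= psum l j.
Proof.
move=> /andP[]; elim: j => [|j IH] ij jn; first by rewrite (_ : i = 0%N)//; lia.
have [->//|ij'] := eqVneq i j.+1.
rewrite psumS (le_trans (IH _ _)) ?lerDl ?ltW ?l0//; lia.
Qed.

Lemma psum_segment_itv i s : (i < n)%N -> 0 <= s <= 1 ->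
  0 <= psum l i + l i * s <= 1.
Proof.
move=> ni /andP[s0 s1]; have li := l0 ni.
have := @psum_le 0%N i ltac:(lia); have := @psum_le i.+1 n ltac:(lia).
rewrite psumS psum0 l1 => h1 h2; apply/andP; split.
  by rewrite addr_ge0// mulr_ge0// ltW.
by apply: le_trans h1; rewrite lerD2l ler_piMr// ltW.
Qed.

Lemma psum_cover m t : (m < n)%N -> 0 <= t <= psum l m.+1 ->
  exists i s, [/\ (i < n)%N, 0 <= s <= 1 & t = psum l i + l i * s].
Proof.
elim: m => [|m IH] mn /andP[t0 tm].
  exists 0%N, (t / l 0%N); have l00 := l0 mn; split=> //.
    apply/andP; split; first by rewrite divr_ge0// ltW.
    by rewrite ler_pdivrMr// mul1r; move: tm; rewrite psumS psum0 add0r.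
  by rewrite psum0 add0r mulrC divfK// gt_eqF.
have [tm'|tm'] := leP t (psum l m.+1); first by apply: IH; [lia|rewrite t0].
have lm0 := l0 mn.
exists m.+1, ((t - psum l m.+1) / l m.+1); split=> //.
  apply/andP; split; first by rewrite divr_ge0 ?subr_ge0// ltW.
  by rewrite ler_pdivrMr// mul1r; move: tm; rewrite (psumS _ m.+1); lra.
by rewrite mulrC divfK ?gt_eqF// addrC subrK.
Qed.

Lemma is_concat_uniq u C C' : is_concat n l u C -> is_concat n l u C' ->
  forall t, C t = C' t.
Proof.
move=> [Cp Cu] [Cp' Cu'] t; rewrite -Cp -Cp'.
have n0 : (0 < n)%N.
  by case: (n) l1 => //; rewrite psum0 => /eqP; rewrite eq_sym oner_eq0.
have [|i [s [ni s01 ->]]] := @psum_cover n.-1 (pi_set t) ltac:(lia).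
  by rewrite prednK// l1 pi_set_itv.
by rewrite Cu ?Cu'.
Qed.

Variable u : nat -> R -> X.
Hypothesis u_pi : forall i, (i < n)%N -> forall t, u i (pi_set t) = u i t.
Hypothesis u_comp : forall i, (i.+1 < n)%N -> u i 1 = u i.+1 0.

Lemma u_le0 i t : (i < n)%N -> t <= 0 -> u i t = u i 0.
Proof. by move=> ni t0; rewrite -u_pi// pi_set_le0. Qed.

Lemma u_ge1 i t : (i < n)%N -> 1 <= t -> u i t = u i 1.
Proof. by move=> ni t0; rewrite -u_pi// pi_set_ge1. Qed.

Lemma concat_start m t : (m < n)%N -> t <= 0 -> concat l u m t = u 0%N 0.
Proof.
elim: m => [|m IH] mn t0 /=.
  by rewrite u_le0// mulr_le0_ge0// invr_ge0 ltW// l0.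
rewrite ifT ?IH//; first by lia.
by apply: le_trans t0 _; rewrite -(psum0 l) psum_le//; lia.
Qed.

Lemma concat_end m t : (m < n)%N -> psum l m.+1 <= t -> concat l u m t = u m 1.
Proof.
case: m => [|m] mn; rewrite psumS => pt /=; have lm := l0 mn.
  by rewrite u_ge1// ler_pdivlMr// mul1r; move: pt; rewrite psum0 add0r.
rewrite ifF; last by apply/negbTE; rewrite -ltNge; lra.
by rewrite u_ge1// ler_pdivlMr// mul1r; lra.
Qed.

Lemma concat_segment m i s : (m < n)%N -> (i <= m)%N -> 0 <= s <= 1 ->
  concat l u m (psum l i + l i * s) = u i s.
Proof.
move=> mn im /andP[s0 s1]; elim: m mn im => [|m IH] mn im /=; have lm := l0 mn.
  have -> : i = 0%N by lia.
  by rewrite psum0 add0r [l _ * s]mulrC mulfK// gt_eqF.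
have [iE|im'] := eqVneq i m.+1; last first.
  rewrite ifT; first by apply: IH; lia.
  have := @psum_le i.+1 m.+1 ltac:(lia); rewrite psumS.
  have := l0 (ltac:(lia) : (i < n)%N) => li; apply: le_trans.
  by rewrite lerD2l ler_piMr// ltW.
rewrite iE; have [s00|sn0] := eqVneq s 0.
  by rewrite s00 mulr0 addr0 lexx concat_end// ?u_comp//; lia.
rewrite ifF; last first.
  by apply/negbTE; rewrite -ltNge ltrDl mulr_gt0// lt_def sn0.
by rewrite addrC addKr [l _ * s]mulrC mulfK// gt_eqF.
Qed.

Lemma concat_is_concat : (0 < n)%N -> is_concat n l u (concat l u n.-1).
Proof.
move=> n0; have nn : (n.-1 < n)%N by lia.
split=> [t|i ni s s01]; last by apply: concat_segment => //; lia.
have [t0|t0] := leP t 0; first by rewrite pi_set_le0// !concat_start.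
have [t1|t1] := leP 1 t; last by rewrite pi_set_id// !ltW.
by rewrite pi_set_ge1// !concat_end// ?prednK// l1.
Qed.

(** At a time t in the interval of u_j, the summands with i > j vanish, because
    u_i is constant on the negative times, and those with i < j are
    phi (u_i 1) - phi (u_i 0), whose sum telescopes since u_i 1 = u_(i+1) 0. *)
Lemma concat_telescope (phi : X -> R) m t : (m < n)%N ->
  phi (concat l u m t) = phi (u 0%N 0) +
    \sum_(i < m.+1) (phi (u i ((t - psum l i) / l i)) - phi (u i 0)).
Proof.
elim: m => [|m IH] mn /=.
  by rewrite big_ord1 psum0 subr0 addrC subrK.
have lm := l0 mn; rewrite big_ord_recr/= addrA -IH; last by lia.
case: ifPn => [tm|]; last rewrite -ltNge => tm.
  by rewrite (@u_le0 m.+1)// ?subrr ?addr0// mulr_le0_ge0 ?subr_le0// invr_ge0 ltW.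
rewrite concat_end; [|lia|exact: ltW].
by rewrite u_comp// addrC subrK.
Qed.

End concatenation.

(** * Smoothness of concatenations in a reflexive space *)

Section path_spaces.
Variables (R : realType) (X : diffSpace R).

Lemma path_at_pi (u : pathSpace X) t : path_at u (pi_set t) = path_at u t.
Proof. by have := svalP u => /(congr1 (fun f => f t)). Qed.

Lemma path_ext (u v : pathSpace X) : (forall t, path_at u t = path_at v t) -> u = v.
Proof.
case: u v => [[u su] up] [[v sv] vp] uv.
have E : u = v by apply/funext.
move: su up sv vp {uv}; rewrite E => su up sv vp.
by rewrite (Prop_irrelevance su sv) in up *; rewrite (Prop_irrelevance up vp).
Qed.

Lemma path_at_plot m (W : set 'rV[R]_m) (u : 'rV[R]_m -> pathSpace X)
    (q : 'rV[R]_m -> R) :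
  is_plot W u -> smooth_on W q -> is_plot W (fun w => path_at (u w) (q w)).
Proof.
move=> [oW pu] sq; apply: (pu m W id q) => //; first exact: smooth_on_rV_id.
Qed.

(** By reflexivity it is enough to compose with a smooth phi, and the
    telescoping formula is a finite sum of smooth functions. *)
Lemma concat_plot n m (W : set 'rV[R]_m) (l : 'rV[R]_m -> nat -> R)
    (u : 'rV[R]_m -> nat -> pathSpace X) (q : 'rV[R]_m -> R) :
  reflexive_space X -> (0 < n)%N -> open W ->
  (forall i, (i < n)%N -> smooth_on W (fun w => l w i)) ->
  (forall w i, (i < n)%N -> 0 < l w i) ->
  (forall w, psum (l w) n = 1) ->
  (forall i, (i < n)%N -> is_plot W (fun w => u w i)) ->
  (forall w i, (i.+1 < n)%N -> path_at (u w i) 1 = path_at (u w i.+1) 0) ->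
  smooth_on W q ->
  is_plot W (fun w => concat (l w) (fun i => path_at (u w i)) n.-1 (q w)).
Proof.
move=> reflX n0 oW sl l0 l1 pu uc sq; apply: reflX => // phi sphi k.
have sc v c : is_plot W v -> smooth_on W c ->
    smooth_on W (fun w => phi (path_at (v w) (c w))).
  by move=> pv sc; exact: (sphi _ _ _ (path_at_plot pv sc)).2.
have scst c := @smooth_on_cst R m W c.
have sps i : (i <= n)%N -> smooth_on W (fun w => psum (l w) i).
  elim: i => [|i IH] ni.
    by move=> k'; apply: Ck_ext (scst 0 k') => // w _; rewrite psum0.
  move=> k'; apply: Ck_ext (smooth_onD oW (IH (ltnW ni)) (sl i ni) k') => // w _.
  by rewrite psumS.
have := smooth_onD oW (sc _ _ (pu 0%N n0) (scst 0)) (@smooth_on_sum R m _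
  (index_enum 'I_n.-1.+1) W (fun i w =>
    phi (path_at (u w i) ((q w - psum (l w) i) / l w i)) - phi (path_at (u w i) 0)) oW _).
move=> H; apply: Ck_ext (H _ k) => // [w Ww|i].
  rewrite /= (@concat_telescope R X n)//; first exact: l0.
  - by move=> i ni t; exact: path_at_pi.
  - exact: uc.
  - by lia.
have ni : (i < n)%N by have := ltn_ord i; lia.
apply: smooth_onB => //; last exact: sc (pu _ ni) (scst 0).
apply: sc (pu _ ni) _; apply: smooth_onM => //.
  by apply: smooth_onB => //; apply: sps; exact: ltnW.
by apply: smooth_onV => // [w Ww|]; [rewrite gt_eqF ?l0|exact: sl].
Qed.

End path_spaces.

(** * The multiplications of the path category *)

Section multiplication.
Variables (R : realType) (X : diffSpace R).
Hypothesis reflX : reflexive_space X.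

Notation src := (fun u : pathSpace X => path_at u 0).
Notation tgt := (fun u : pathSpace X => path_at u 1).
Notation chains := (chainSpace (src : pathSpace X -> X) (tgt : pathSpace X -> X)).

(** The position is a natural number, with a default path beyond n, to match
    the indexing of lengths. *)
Definition chain_nth n (n2 : (2 <= n)%N) (g : chains n) (i : nat) : pathSpace X :=
  sval g (insubd (first_ord n2) i).

Lemma chain_nthE n (n2 : (2 <= n)%N) (g : chains n) (i : 'I_n) :
  chain_nth n2 g i = sval g i.
Proof.
rewrite /chain_nth; congr (sval g _); apply: val_inj.
by rewrite insubdK//; exact: ltn_ord.
Qed.

Lemma chain_nth_comp n (n2 : (2 <= n)%N) (g : chains n) i : (i.+1 < n)%N ->
  path_at (chain_nth n2 g i) 1 = path_at (chain_nth n2 g i.+1) 0.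
Proof.
move=> ni; apply: (svalP g); rewrite !insubdK//; exact: ltnW.
Qed.

Definition concat_chain n (n2 : (2 <= n)%N) (a : complexSpace R n)
    (g : chains n) : R -> X :=
  concat (lengths n2 a) (fun i => path_at (chain_nth n2 g i)) n.-1.

Lemma concat_chainP n (n2 : (2 <= n)%N) (a : complexSpace R n) (g : chains n) :
  is_concat n (lengths n2 a) (fun i => path_at (chain_nth n2 g i))
    (concat_chain n2 a g).
Proof.
apply: concat_is_concat; [exact: lens_gt0 (lengthsP n2 a)|
  exact: lens_psum1 (lengthsP n2 a)|by move=> *; exact: path_at_pi|
  exact: chain_nth_comp|exact: ltnW].
Qed.

Lemma concat_chain_plot n (n2 : (2 <= n)%N) m (W : set 'rV[R]_m)
    (P : 'rV[R]_m -> prodSpace (complexSpace R n) (chains n)) (q : 'rV[R]_m -> R) :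
  is_plot W P -> smooth_on W q ->
  is_plot W (fun w => concat_chain n2 (P w).1 (P w).2 (q w)).
Proof.
move=> [pa pg] sq.
apply: (concat_plot (l := fun w => lengths n2 (P w).1)
   (u := fun w => chain_nth n2 (P w).2)) => //.
- exact: ltnW.
- exact: plot_open pa.
- by move=> i ni; exact: (lengths_smooth n2 ni pa).2.
- by move=> w; exact: lens_gt0 (lengthsP n2 _).
- by move=> w; exact: lens_psum1 (lengthsP n2 _).
- by move=> i ni; exact: (pg.2 (insubd (first_ord n2) i)).
- by move=> w; exact: chain_nth_comp.
Qed.

Lemma concat_chain_smooth n (n2 : (2 <= n)%N) (a : complexSpace R n) (g : chains n) :
  smooth (concat_chain n2 a g : realLine R -> X).
Proof.
move=> m U q [oU sq].
exact: (concat_chain_plot (P := fun=> (a, g)) n2 (plot_cst _ _ oU) sq).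
Qed.

Lemma concat_chain_pi n (n2 : (2 <= n)%N) (a : complexSpace R n) (g : chains n) :
  concat_chain n2 a g \o (@pi_set R) = concat_chain n2 a g.
Proof. by apply/funext => t /=; have [->] := concat_chainP n2 a g. Qed.

Definition path_mul n (n2 : (2 <= n)%N) (p : prodSpace (complexSpace R n) (chains n)) :
    pathSpace X :=
  exist (fun u : mapSpace (realLine R) X => (u : R -> X) \o @pi_set R = u)
    (SmoothMap (concat_chain_smooth n2 p.1 p.2)) (concat_chain_pi n2 p.1 p.2).

Lemma path_mul_smooth n (n2 : (2 <= n)%N) : smooth (path_mul n2).
Proof.
move=> m U P pP; split=> [|k W Q q sQ WU [oW sq]]; first exact: plot_open pP.1.
exact: (concat_chain_plot n2 (plot_comp pP oW sQ WU) sq).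
Qed.

Lemma path_mul_segment n (n2 : (2 <= n)%N) a (g : chains n) (i : 'I_n) s : 0 <= s <= 1 ->
  path_at (path_mul n2 (a, g)) (psum (lengths n2 a) i + lengths n2 a i * s) =
  path_at (sval g i) s.
Proof.
by move=> s01; have [_ H] := concat_chainP n2 a g; rewrite [LHS]H// chain_nthE.
Qed.

Lemma path_mul_src n (n2 : (2 <= n)%N) (a : complexSpace R n) (g : chains n) :
  src (path_mul n2 (a, g)) = src (sval g (first_ord n2)).
Proof.
have := path_mul_segment n2 a g (first_ord n2) (s := 0).
by rewrite lexx ler01 /= psum0 mulr0 addr0 => /(_ isT).
Qed.

Lemma path_mul_tgt n (n2 : (2 <= n)%N) (a : complexSpace R n) (g : chains n) :
  tgt (path_mul n2 (a, g)) = tgt (sval g (last_ord n2)).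
Proof.
have := path_mul_segment n2 a g (last_ord n2) (s := 1).
rewrite lexx ler01 /= mulr1 -psumS prednK; last exact: ltnW.
by rewrite (lens_psum1 (lengthsP n2 a)) => /(_ isT).
Qed.

(** The path on the right runs through the n paths of g on the intervals of the
    subdivision insert *%R (k - 1) s lr ls, which is that of the face point by
    uniqueness of lengths. *)
Lemma path_mul_face r s n k (H : face_index r s n k)
    (rho : complexSpace R r) (kappa : complexSpace R s) (g : chains n)
    (C := path_mul (fi_s H) (kappa, segment H g)) sC tC :
  path_mul (fi_n H) (complex_face H rho kappa, g) =
  path_mul (fi_r H) (rho, @substitute _ _ _ _ _ _ _ _ _ H g C sC tC).
Proof.
apply: path_ext.
have /and4P[r2 s2 /eqP rsn kr] := H.
have kr' : (k.-1 < r)%N by lia.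
have Lr := lengthsP (fi_r H) rho; have Ls := lengthsP (fi_s H) kappa.
set lr := lengths _ _ in Lr *; set ls := lengths _ _ in Ls.
have Ln := lengthsP (fi_n H) (complex_face H rho kappa).
have ls1 := lens_psum1 Ls.
have Ln' : lens n (height (sval (complex_face H rho kappa))) (insert *%R k.-1 s lr ls).
  apply: eq_lens (lens_face r2 s2 rsn kr' Lr Ls) => // i ni.
  by rewrite [RHS]height_face//; exact: svalP kappa.
have ll := lens_functional Ln Ln'.
apply: (@is_concat_uniq R X n _ (lens_gt0 Ln) (lens_psum1 Ln) _ _ _
  (concat_chainP (fi_n H) (complex_face H rho kappa) g)).
split=> [t|i ni t t01]; first exact: path_at_pi.
rewrite ll// (eq_psum ll) ?(ltnW ni)// psum_insert// /insert.
rewrite (_ : chain_nth (fi_n H) g i = sval g (Ordinal ni)); last first.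
  exact: chain_nthE (Ordinal ni).
have [ik|ik] := ltnP i k.-1.
  have ir : (i < r)%N by lia.
  rewrite (@path_mul_segment _ _ _ _ (Ordinal ir))//= /substitute_fun.
  rewrite ifT; last by rewrite /=; lia.
  by congr (path_at (sval g _) t); exact: val_inj.
have [iks|iks] := ltnP i (k.-1 + s).
  have is_ : (i - k.-1 < s)%N by lia.
  rewrite -addrA -mulrA -mulrDr (@path_mul_segment _ _ _ _ (Ordinal kr')); last first.
    exact: psum_segment_itv (lens_gt0 Ls) ls1 _ _ is_ t01.
  rewrite /= /substitute_fun/= ifF; last by lia.
  rewrite ifT; last by lia.
  rewrite /C (@path_mul_segment _ _ _ _ (Ordinal is_))//=.
  by congr (path_at (sval g _) t); apply: val_inj => /=; lia.
have ir : (i - s + 1 < r)%N by lia.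
rewrite (@path_mul_segment _ _ _ _ (Ordinal ir))//= /substitute_fun/=.
rewrite ifF; last by lia.
rewrite ifF; last by lia.
by congr (path_at (sval g _) t); apply: val_inj => /=; lia.
Qed.

End multiplication.

(** * Homotopy units *)

Section unit_homotopies.
Variables (R : realType) (X : diffSpace R).

(** The condition on pi_set makes the reparametrized paths constant on each
    side of [0, 1], so that they are elements of the path space again. *)
Lemma reparam_homotopic (f : R -> R -> R) (F : pathSpace X -> pathSpace X) :
  (forall m (W : set 'rV[R]_m) (s q : 'rV[R]_m -> R), open W ->
     smooth_on W s -> smooth_on W q -> smooth_on W (fun w => f (s w) (q w))) ->
  (forall s t, pi_set (f s (pi_set t)) = pi_set (f s t)) ->
  (forall t, f 1 t = t) ->
  (forall g t, path_at (F g) t = path_at g (f 0 t)) ->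
  smoothly_homotopic F id.
Proof.
move=> sf fpi f1 Ff.
have sH (p : prodSpace (realLine R) (pathSpace X)) :
    smooth (fun t : realLine R => path_at p.2 (f p.1 t)).
  move=> m U q [oU sq]; apply: (path_at_plot (u := fun=> p.2)).
    exact: plot_cst.
  exact: (sf _ _ (fun=> p.1) q oU (@smooth_on_cst R m U p.1) sq).
have piH (p : prodSpace (realLine R) (pathSpace X)) :
    (fun t : R => path_at p.2 (f p.1 t)) \o @pi_set R =
    (fun t : R => path_at p.2 (f p.1 t)).
  by apply/funext => t /=; rewrite -path_at_pi fpi path_at_pi.
exists (fun p => exist
  (fun u : mapSpace (realLine R) X => (u : R -> X) \o @pi_set R = u)
  (SmoothMap (sH p)) (piH p)); split.
- move=> m U P [[oU s1] pP]; split=> // k W Q q sQ WU [oW sq].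
  apply: (path_at_plot (u := fun w => (P (Q w)).2)); first exact: plot_comp pP oW sQ WU.
  apply: (sf _ _ (fun w => (P (Q w)).1)) => // j.
  exact: (@Ck_comp R k m j U W (fun u => (P u).1) Q oW WU (fun i => sQ i j) (s1 j)).
- by move=> g; apply: path_ext => t; rewrite Ff.
- by move=> g; apply: path_ext => t; rewrite /path_at /= f1.
Qed.

Lemma smooth_map_eval : smooth (fun u : pathSpace X => path_at u 0) /\
  smooth (fun u : pathSpace X => path_at u 1).
Proof.
by split=> m U P pP; apply: (path_at_plot pP); exact: smooth_on_cst.
Qed.

Lemma constant_path_smooth : smooth (@constant_path R X).
Proof.
move=> m U P pP; split=> [|k W Q q sQ WU [oW _]]; first exact: plot_open pP.
exact: plot_comp pP oW sQ WU.
Qed.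

Lemma path_precategory : precategory (fun u : pathSpace X => path_at u 0)
  (fun u : pathSpace X => path_at u 1) (@constant_path R X).
Proof.
by have [s0 s1] := smooth_map_eval; split=> //; exact: constant_path_smooth.
Qed.

End unit_homotopies.

Section path_category.
Variables (R : realType) (X : diffSpace R).
Hypothesis reflX : reflexive_space X.

Definition path_form : A_infty_form (fun u : pathSpace X => path_at u 0)
    (fun u : pathSpace X => path_at u 1) :=
  AInftyForm (path_mul_smooth reflX)
    (mul_src := path_mul_src reflX) (mul_tgt := path_mul_tgt reflX)
    (fun r s n k H rho kappa g => @path_mul_face R X reflX r s n k H rho kappa g
       (path_mul_src reflX (fi_s H) kappa (segment H g))
       (path_mul_tgt reflX (fi_s H) kappa (segment H g))).

(** The product of two paths uses the subdivision (1/2, 1/2), as K_2 is a point. *)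
Lemma path_mul2 (g : chainSpace (fun u : pathSpace X => path_at u 0)
    (fun u : pathSpace X => path_at u 1) 2) (C : R -> X) :
  (forall t, C (pi_set t) = C t) ->
  (forall s, 0 <= s <= 1 -> C (2^-1 * s) = path_at (sval g ord0) s) ->
  (forall s, 0 <= s <= 1 -> C (2^-1 + 2^-1 * s) = path_at (sval g ord_max) s) ->
  forall t, path_at (path_mul reflX (leqnn 2) (base2 R, g)) t = C t.
Proof.
move=> Cpi C0 C1; have L := lengthsP (leqnn 2) (base2 R).
have L' : lens 2 (height (sval (base2 R))) (fun=> 2%:R^-1).
  by apply: lens_corolla => // i i2; exact: height_base.
have ll := lens_functional L L'.
apply: (@is_concat_uniq R X 2 _ (lens_gt0 L) (lens_psum1 L) _ _ _
  (concat_chainP (leqnn 2) (base2 R) g)).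
split=> // i i2 s s01; rewrite ll// (eq_psum ll) ?(ltnW i2)//.
rewrite -[i]/(val (Ordinal i2)) chain_nthE.
case: i i2 => [|[|//]] i2 /=.
  rewrite psum0 add0r C0//; congr (path_at (sval g _) s); exact: val_inj.
rewrite psumS psum0 add0r C1//; congr (path_at (sval g _) s); exact: val_inj.
Qed.

(** The speed in the unit homotopies, from 2 at s = 0 to 1 at s = 1; it stays in
    [1, 2] for all real s. *)
Definition stretch (s : R) : R := 2 - smooth_step s.

Lemma stretch_ge1 s : 1 <= stretch s.
Proof. by rewrite /stretch; have /andP[_] := smooth_step_itv s; lra. Qed.

Lemma pi_set_affine (c t b : R) : 1 <= c -> 1 - c <= b <= 0 ->
  pi_set (c * pi_set t + b) = pi_set (c * t + b).
Proof.
move=> c1 /andP[cb b0].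
have [t0|t0] := leP t 0; first by rewrite (pi_set_le0 t0) !pi_set_le0//; nra.
have [t1|t1] := leP 1 t; first by rewrite (pi_set_ge1 t1) !pi_set_ge1//; nra.
by rewrite (pi_set_id (t := t))// !ltW.
Qed.

Lemma smooth_on_stretch m (W : set 'rV[R]_m) (s : 'rV[R]_m -> R) : open W ->
  smooth_on W s -> smooth_on W (fun w => stretch (s w)).
Proof.
move=> oW ss; apply: smooth_onB => //; first exact: smooth_on_cst.
exact: smooth_on_step.
Qed.

(** The time is c t + (1 - c), so the constant part at the beginning is left
    out progressively. *)
Lemma left_unit_homotopic :
  smoothly_homotopic (left_unit_mul path_form (path_precategory X)) id.
Proof.
apply: (@reparam_homotopic R X (fun s t => stretch s * t + (1 - stretch s))).
- move=> m W s q oW ss sq; apply: smooth_onD => //.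
    by apply: smooth_onM => //; exact: smooth_on_stretch.
  by apply: smooth_onB => //; [exact: smooth_on_cst|exact: smooth_on_stretch].
- by move=> s t; have ? := stretch_ge1 s; apply: pi_set_affine => //; lra.
- by move=> t; rewrite /stretch smooth_step1//; lra.
move=> g; rewrite /stretch smooth_step0//; apply: path_mul2.
- by move=> t; rewrite -path_at_pi pi_set_affine ?path_at_pi//; lra.
- move=> s /andP[s0 s1]; rewrite -path_at_pi pi_set_le0//; lra.
- by move=> s s01; congr path_at; lra.
Qed.

Lemma right_unit_homotopic :
  smoothly_homotopic (right_unit_mul path_form (path_precategory X)) id.
Proof.
apply: (@reparam_homotopic R X (fun s t => stretch s * t + 0)).
- move=> m W s q oW ss sq; apply: smooth_onD => //; last exact: smooth_on_cst.
  by apply: smooth_onM => //; exact: smooth_on_stretch.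
- by move=> s t; have ? := stretch_ge1 s; apply: pi_set_affine => //; lra.
- by move=> t; rewrite /stretch smooth_step1//; lra.
move=> g; rewrite /stretch smooth_step0//; apply: path_mul2.
- by move=> t; rewrite -path_at_pi pi_set_affine ?path_at_pi//; lra.
- by move=> s s01; congr path_at; lra.
- by move=> s /andP[s0 s1]; rewrite -path_at_pi pi_set_ge1//; lra.
Qed.

End path_category.

Theorem theorem6p11 (R : realType) (X : diffSpace R) :
  reflexive_space X ->
  h_unital_A_infty_category
    (fun u : pathSpace X => path_at u 0)
    (fun u : pathSpace X => path_at u 1)
    (@constant_path R X).
Proof.
move=> reflX; exists (path_precategory X), (path_form reflX); split.
  exact: left_unit_homotopic.
exact: right_unit_homotopic.
Qed.
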